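(* Let $a,b$ be coprime positive integers with $b\ge 2$, let $X=NC(a,b)$, let the cyclic group $C=\mathbb{Z}_{b-1}$ act on $X$ with generator acting by $\mathrm{rot}$, and let $X(q)=\mathrm{Cat}_q(a,b)=\frac{1}{[a+b]_q}{a+b\brack a}_q$. Then $(X,C,X(q))$ exhibits the cyclic sieving phenomenon.
   Context: An $a,b$-Dyck path is a lattice path from $(0,0)$ to $(b,a)$ with unit north steps $N$ and east steps $E$ staying above the line $y=\frac{a}{b}x$; write it as $D=N^{v_0}EN^{v_1}E\cdots N^{v_{b-1}}E$, $v_i\ge 0$. A vertical run of length $v$ is a $P$-rise if $v>a/b$ and a $Q$-rise if $v<a/b$. For $1\le i\le b-1$ the label $i$ is the point $(i,v_0+\dots+v_{i-1})$. If $v_i>0$, the laser $\ell(i)$ is the segment of slope $a/b$ from label $i$ going northeast until it next meets $D$ (in the interior of an east step). $\ell(D)$ is the set of pairs $(i,j)$ with $\ell(i)$ ending on the east step whose west endpoint has $x$-coordinate $j$. The labeled pair $\pi(D)=(P,Q)$ of set partitions of $[b-1]=\{1,\dots,b-1\}$: $i,j$ in the same block of $P$ iff labels $i,j$ are not separated by any laser (label $k$ lies strictly below $\ell(k)$), and a block $B\in P$ gets rank $v_{\min(B)-1}$; $Q$ is the equivalence relation generated by $i\sim j$ whenever $\ell(i),\ell(j)$ end on the same east step immediately following a $Q$-rise, or $(i,j)\in\ell(D)$, or $(j,i)\in\ell(D)$, and a block $B\in Q$ gets rank $v_{\max(B)}$. $NC(a,b)=\{\pi(D): D \text{ an } a,b\text{-Dyck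 path}\}$ (pairs with ranks). $\mathrm{rot}$ acts on such labeled pairs by $i\mapsto i+1$ ($b-1\mapsto 1$) on every block of both partitions, ranks kept; $NC(a,b)$ is closed under $\mathrm{rot}$. Notation: $[n]_q=1+q+\dots+q^{n-1}$, $[n]!_q=[1]_q\cdots[n]_q$, ${n\brack k}_q=\frac{[n]!_q}{[k]!_q[n-k]!_q}$. Cyclic sieving: for a finite set $X$, a finite cyclic group $C=\langle c\rangle$ acting on $X$, and $X(q)\in\mathbb{N}[q]$, the triple exhibits the cyclic sieving phenomenon if, with $\zeta$ a root of unity of multiplicative order $|C|$, $X(\zeta^d)=|\{x\in X: c^d x=x\}|$ for all $d\ge 0$. *)

(* Defs.v *)
From HB Require Import structures.
From mathcomp Require Import all_boot all_order all_algebra all_fingroup all_field.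
Set Implicit Arguments.
Unset Strict Implicit.
Unset Printing Implicit Defensive.
Import Order.TTheory GRing.Theory Num.Theory.

(* The word N^{v_0} E N^{v_1} E ... N^{v_{b-1}} E is represented by the tuple
   (v_0, ..., v_{b-1}); the bound v_i <= a is no restriction, as the v_i sum
   to a. *)
Section DyckPaths.
Variables a b : nat.
Implicit Type D : b.-tuple 'I_a.+1.

Definition run D (i : nat) : 'I_a.+1 := nth ord0 D i.

(* The ordinate at which D arrives on the vertical line x = i, so that the
   label i is the point (i, height D i) and the j-th east step goes from
   (j, height D j.+1) to (j + 1, height D j.+1). *)
Definition height D (i : nat) : nat := \sum_(k < i) run D k.

Definition dyck : {set b.-tuple 'I_a.+1} :=
  [set D | (height D b == a) && [forall i : 'I_b.+1, a * i <= b * height D i]].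

(* The line of slope a/b through label i meets the interior of the j-th east
   step:  y_i + (a/b)(j - i) < y_{j+1} < y_i + (a/b)(j + 1 - i),
   multiplied by b and rearranged to avoid subtraction. *)
Definition crosses D (i j : nat) : bool :=
  b * height D i + a * j < b * height D j.+1 + a * i
    < b * height D i + a * j.+1.

(* (i, j) \in l(D): the laser l(i) exists and j is the first east step met. *)
Definition laser D (i j : nat) : bool :=
  [&& 0 < i, 0 < run D i, i <= j, j < b, crosses D i j &
      [forall k : 'I_j, (i <= k) ==> ~~ crosses D i k]].

(* Label i lies strictly above the laser l(k), seen as a segment: i belongs to
   its range of abscissas, whose right end is strictly between m and m + 1. The
   strict inequality puts label k on the lower side of l(k). *)
Definition above D (k i : nat) : bool :=
  [exists m : 'I_b, [&& laser D k m, k <= i <= m &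
     b * height D k + a * i < b * height D i + a * k]].

Definition separates D (k i j : nat) : bool := above D k i != above D k j.

Definition Qrise D (i : nat) : bool := b * run D i < a.

(* The element i of 'I_b.-1 stands for the label i + 1 of [b - 1]. *)
Definition label (i : 'I_b.-1) : nat := i.+1.

Definition Prel D : rel 'I_b.-1 := fun i j =>
  [forall k : 'I_b, ~~ separates D k (label i) (label j)].

Definition Qgen D : rel 'I_b.-1 := fun i j =>
  [|| [exists m : 'I_b,
         [&& Qrise D m, laser D (label i) m & laser D (label j) m]],
      laser D (label i) (label j) | laser D (label j) (label i)].

(* Qgen is symmetric, so its reflexive transitive closure is the equivalence
   relation it generates. *)
Definition Qrel D : rel 'I_b.-1 := connect (Qgen D).

Definition minlabel (B : {set 'I_b.-1}) : nat :=
  \big[minn/b]_(i in B) label i.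

Definition maxlabel (B : {set 'I_b.-1}) : nat := \max_(i in B) label i.

(* A ranked set partition is the set of its pairs (block, rank). *)
Local Notation ranked := {set {set 'I_b.-1} * 'I_a.+1}.

Local Notation labeled_pair := (ranked * ranked)%type.

Definition Ppart D : ranked :=
  [set (B, run D (minlabel B).-1) | B in equivalence_partition (Prel D) setT].

Definition Qpart D : ranked :=
  [set (B, run D (maxlabel B)) | B in equivalence_partition (Qrel D) setT].

Definition NC : {set labeled_pair} := [set (Ppart D, Qpart D) | D in dyck].

(* In terms of labels, ordS is i |-> i + 1 for i < b - 1 and b - 1 |-> 1. *)
Definition rot_block (x : {set 'I_b.-1} * 'I_a.+1) : {set 'I_b.-1} * 'I_a.+1 :=
  (@ordS b.-1 @: x.1, x.2).

Definition rot_ranked (L : ranked) : ranked := rot_block @: L.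

Definition rot (x : labeled_pair) : labeled_pair :=
  (rot_ranked x.1, rot_ranked x.2).

(* For b >= 2 the additive group of 'I_(b.-2).+1 is Z_{b-1}, also when b = 2,
   where 'Z_1 would be Z/2. *)
Definition rot_fun (x : labeled_pair) (k : 'I_(b.-2).+1) : labeled_pair :=
  iter k rot x.

Lemma iter_ordS k (i : 'I_b.-1) : val (iter k (@ordS b.-1) i) = (i + k) %% b.-1.
Proof.
elim: k => [|k IHk] /=; first by rewrite addn0 modn_small.
by rewrite IHk -addn1 modnDml addn1 addnS.
Qed.

Lemma iter_imset (T : finType) (f : T -> T) k (A : {set T}) :
  iter k (fun B : {set T} => f @: B) A = iter k f @: A.
Proof.
elim: k => [|k IHk] /=; first by rewrite imset_id.
by rewrite IHk -imset_comp.
Qed.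

Lemma iter_rot_order (x : labeled_pair) : iter (b.-2).+1 rot x = x.
Proof.
have ordSn (i : 'I_b.-1) : iter (b.-2).+1 (@ordS b.-1) i = i.
  apply: val_inj; rewrite iter_ordS; case: i => i /= ltib.
  by rewrite (ltn_predK ltib) modnDr modn_small.
have blockE k z :
    iter k rot_block z = (iter k (fun B : {set 'I_b.-1} => @ordS b.-1 @: B) z.1, z.2).
  by elim: k => [|k IHk] /=; [case: z | rewrite IHk].
have rotL (L : ranked) : iter (b.-2).+1 rot_ranked L = L.
  rewrite iter_imset -[RHS]imset_id; apply: eq_imset => -[B r].
  by rewrite blockE iter_imset (eq_imset _ ordSn) imset_id.
have iterE k y : iter k rot y = (iter k rot_ranked y.1, iter k rot_ranked y.2).
  by elim: k => [|k IHk] /=; [case: y | rewrite IHk].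
by rewrite iterE !rotL; case: x.
Qed.

Lemma rot_fun_is_action : is_action [set: 'I_(b.-2).+1] rot_fun.
Proof.
have iter_mod m x : iter (m %% (b.-2).+1) rot x = iter m rot x.
  rewrite [in RHS](divn_eq m (b.-2).+1) addnC iterD; congr (iter _ _ _).
  by elim: (m %/ _) => // q IHq; rewrite mulSn iterD -IHq iter_rot_order.
apply: is_total_action => [x //|x k l].
by rewrite /rot_fun /= iter_mod addnC iterD.
Qed.

Canonical rot_action := Action rot_fun_is_action.

End DyckPaths.

Local Open Scope ring_scope.

Definition qint (n : nat) : {poly algC} := \poly_(i < n) 1.

Definition qfact (n : nat) : {poly algC} := \prod_(1 <= i < n.+1) qint i.

(* The Euclidean quotients below are exact: qbinom for k <= n, and qCat for
   coprime a and b. *)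
Definition qbinom (n k : nat) : {poly algC} :=
  qfact n %/ (qfact k * qfact (n - k)).

Definition qCat (a b : nat) : {poly algC} := qbinom (a + b) a %/ qint (a + b).

(* (X, C, Xq) exhibits the cyclic sieving phenomenon, where C = <c> acts on X
   via [to]. Algebraic numbers suffice, as they contain all complex roots of
   unity. *)
Definition cyclic_sieving (gT : finGroupType) (T : finType)
    (to : {action gT &-> T}) (X : {set T}) (C : {group gT}) (c : gT)
    (Xq : {poly algC}) : Prop :=
  [/\ C :=: <[c]>%g,
      [acts C, on X | to],
      Xq \is a polyOver Num.nat &
      forall zeta : algC, #|C|.-primitive_root zeta ->
      forall d : nat, Xq.[zeta ^+ d] = #|('Fix_(X | to)[c ^+ d])%g|%:R].

(* Main.v *)
Require Import Defs.
From mathcomp Require Import all_boot all_order all_algebra all_fingroup all_field.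
From mathcomp Require Import all_solvable.
From mathcomp Require Import zify ring lra.
From mathcomp Require realalg.

(* Put b = n + 1 and g(i) = b height(i) - a i.  From label i, look back to the
   last c < i with g(c) < g(i) and forward to the first c >= i with
   g(c + 1) < g(i): the labels with the same first (second) position c form the
   blocks of P (of Q), of rank v_c.  So pi(D) is a plane tree whose n edges are
   the labels and whose b vertices are the positions 0, ..., n, weighted by the
   v_c; rot rotates the edges cyclically.

   A rotation of order m > 1 permutes the b = n + 1 vertices and fixes exactly
   one: counting modulo a prime divisor of m gives existence, and two invariant
   blocks would cross.  Rotating the fixed vertex to the first or last position,
   D becomes a run r together with a word w of length n that is periodic with
   period k = n/m and has m (w_1 + ... + w_k) <= a.  Conversely every such w has
   a cyclic shift which, preceded or followed by the remaining run, is a Dyck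
   path.  Hence there are C(k + floor(a/m), k) fixed points for m > 1, while for
   m = 1 the cycle lemma counts all of them.

   On the other side Cat_q [b]_q is the q-binomial [a+n, a]_q, which the
   q-Lucas argument evaluates at roots of unity of order m dividing n.
   Cat_q is in N[q] because the Gaussian coefficients are unimodal. *)

Set Implicit Arguments.
Unset Strict Implicit.
Unset Printing Implicit Defensive.
Import Order.TTheory GRing.Theory Num.Theory.
Local Open Scope ring_scope.

(** * Unimodality of the Gaussian coefficients *)

(** Coprimality makes g injective on 0, ..., n, so neither search ever meets a tie, and the sign of
    g(c + 1) - g(c) decides whether the position c is a vertex of P or of Q. The obstacle is that
    the rotation is not a cyclic shift of the runs: the run of one block jumps to the front and the
    last run fills the gap, so a symmetry of the pair is invisible on D. It becomes visible once the
    invariant vertex sits at an end of the path, for turning about that vertex is a cyclic shift of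
    the n other runs. Hence the boolean [o], the type of the central vertex, in most statements;
    reversal of g exchanges the two types. The word w need not record the type: it is P exactly when
    the remaining run exceeds a/b. The identity has no distinguished vertex and is counted
    separately. Correspondingly, at roots of unity of order m dividing n, [b]_q is 1 if m > 1 and b
    if m = 1. *)

Section Unimodality.
Import realalg.
Variable n : nat.
Implicit Types (S T : {set 'I_n.+1}) (j l : 'I_n).

Let pos j : 'I_n.+1 := widen_ord (leqnSn n) j.
Let nxt j : 'I_n.+1 := lift ord0 j.

Definition subset_sum S : nat := \sum_(i in S) i.

Definition swap_next j S : {set 'I_n.+1} :=
  [set i | tperm (pos j) (nxt j) i \in S].

Definition can_lower j S := (nxt j \in S) && (pos j \notin S).
Definition can_raise j S := (pos j \in S) && (nxt j \notin S).

Lemma swap_nextK j : involutive (swap_next j).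
Proof. by move=> S; apply/setP => i; rewrite !inE tpermK. Qed.

Lemma can_lower_swap j S : can_lower j (swap_next j S) = can_raise j S.
Proof. by rewrite /can_lower /can_raise !inE tpermL tpermR. Qed.

Lemma card_swap_next j S : #|swap_next j S| = #|S|.
Proof. by rewrite -[RHS](card_preimset S (@perm_inj _ (tperm (pos j) (nxt j)))). Qed.

Lemma subset_sum_swap j S :
  can_lower j S -> subset_sum S = (subset_sum (swap_next j S)).+1.
Proof.
case/andP=> nS pS.
have neq : pos j != nxt j by apply/negP => /eqP /(congr1 val) /=; rewrite /bump; lia.
have -> : swap_next j S = pos j |: (S :\ nxt j).
  apply/setP => i; rewrite !inE; case: tpermP => [->|->|/eqP inp /eqP inn].
  - by rewrite nS eqxx.
  - by rewrite (negbTE pS) eq_sym (negbTE neq) eqxx.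
  - by rewrite (negbTE inp) inn.
rewrite /subset_sum big_setU1 /= ?inE ?negb_and ?pS ?orbT //.
by rewrite (big_setD1 _ nS) /=.
Qed.

Lemma far_swapE j l : (j.+1 < l)%N || (l.+1 < j)%N ->
  [/\ forall S, swap_next j (swap_next l S) = swap_next l (swap_next j S),
      forall S, can_raise j (swap_next l S) = can_raise j S &
      forall S, can_raise l (swap_next j S) = can_raise l S].
Proof.
move=> far.
have neqs : [/\ pos j != pos l, pos j != nxt l, nxt j != pos l & nxt j != nxt l].
  by split; apply/negP => /eqP /(congr1 val) /=; rewrite /bump /=; lia.
case: neqs => n1 n2 n3 n4.
have [m1 m2 m3 m4] : [/\ pos l != pos j, nxt l != pos j, pos l != nxt j & nxt l != nxt j].
  by split; rewrite eq_sym.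
split=> S; last 2 first.
- by rewrite /can_raise !inE !tpermD.
- by rewrite /can_raise !inE !tpermD.
apply/setP => i; rewrite !inE; congr (_ \in S).
case: (tpermP (pos j) (nxt j) i) => [->|->|/eqP ip /eqP iq];
  rewrite ?(tpermD m1 m2) ?(tpermD m3 m4).
- by rewrite tpermL.
- by rewrite tpermR.
case: tpermP => [_|_|/eqP jp /eqP jq].
- by rewrite tpermD.
- by rewrite tpermD.
- by rewrite tpermD // eq_sym.
Qed.

(** This is the relation [E, F] = H of the raising, lowering and weight operators, read as an
    identity of quadratic forms. For j and l at distance at least 2 the swaps commute, and
    reindexing by both carries one mixed term to the other. For neighbours both products of
    indicators vanish. For j = l what remains is [can_raise] minus [can_lower], the difference of
    two membership bits. *)
Lemma sum_raise_lower (R : comPzRingType) (f : {set 'I_n.+1} -> R) (c : 'I_n -> R) :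
  \sum_T (\sum_j c j * (can_lower j T)%:R * f (swap_next j T)) ^+ 2 =
  \sum_T (\sum_j c j * (can_raise j T)%:R * f (swap_next j T)) ^+ 2 +
  \sum_(T : {set 'I_n.+1}) (\sum_j c j ^+ 2 * ((pos j \in T)%:R - (nxt j \in T)%:R)) * f T ^+ 2.
Proof.
have expand (P : 'I_n -> {set 'I_n.+1} -> bool) :
    \sum_T (\sum_j c j * (P j T)%:R * f (swap_next j T)) ^+ 2 =
    \sum_j \sum_l c j * c l *
      \sum_T (P j T)%:R * (P l T)%:R * (f (swap_next j T) * f (swap_next l T)).
  under eq_bigr => T _ do rewrite expr2 big_distrlr /=.
  rewrite exchange_big; apply: eq_bigr => j _.
  rewrite exchange_big; apply: eq_bigr => l _.
  by rewrite mulr_sumr; apply: eq_bigr => T _; ring.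
rewrite !expand.
have -> : \sum_(T : {set 'I_n.+1})
      (\sum_j c j ^+ 2 * ((pos j \in T)%:R - (nxt j \in T)%:R)) * f T ^+ 2 =
    \sum_j c j ^+ 2 * \sum_(T : {set 'I_n.+1}) ((pos j \in T)%:R - (nxt j \in T)%:R) * f T ^+ 2.
  under eq_bigr => T _ do rewrite mulr_suml.
  rewrite exchange_big; apply: eq_bigr => j _.
  by rewrite mulr_sumr; apply: eq_bigr => T _; ring.
rewrite -big_split; apply: eq_bigr => j _.
rewrite (bigD1 j) //= [in RHS](bigD1 j) //= addrAC; congr (_ + _); last first.
  apply: eq_bigr => l lj; congr (_ * _).
  have [far|near] := boolP ((j.+1 < l)%N || (l.+1 < j)%N); last first.
    rewrite !big1 // => T _.
      suff -> : (can_raise j T)%:R * (can_raise l T)%:R = 0 :> R by rewrite mul0r.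
      rewrite -natrM mulnb /can_raise.
      case: (ltngtP j l) (lj) => [jl _|jl _|/val_inj -> /eqP //].
        have -> : pos l = nxt j by apply: val_inj; rewrite /= /bump /=; lia.
        by case: (nxt j \in T); rewrite /= ?andbF ?andFb.
      have -> : pos j = nxt l by apply: val_inj; rewrite /= /bump /=; lia.
      by case: (nxt l \in T); rewrite /= ?andbF ?andFb.
    suff -> : (can_lower j T)%:R * (can_lower l T)%:R = 0 :> R by rewrite mul0r.
    rewrite -natrM mulnb /can_lower.
    case: (ltngtP j l) (lj) => [jl _|jl _|/val_inj -> /eqP //].
      have -> : pos l = nxt j by apply: val_inj; rewrite /= /bump /=; lia.
      by case: (nxt j \in T); rewrite /= ?andbF ?andFb.
    have -> : pos j = nxt l by apply: val_inj; rewrite /= /bump /=; lia.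
    by case: (nxt l \in T); rewrite /= ?andbF ?andFb.
  have [comm rj rl] := far_swapE far.
  rewrite (reindex_inj (inv_inj (swap_nextK j))) /=.
  rewrite (reindex_inj (inv_inj (swap_nextK l))) /=.
  apply: eq_bigr => T _.
  rewrite can_lower_swap comm can_lower_swap -comm rj rl swap_nextK.
  by rewrite comm swap_nextK; ring.
rewrite -expr2 -mulrDr; congr (_ * _).
have sqr (b : bool) : b%:R * b%:R = b%:R :> R by case: b; rewrite ?mulr0 ?mulr1.
under eq_bigr => T _ do rewrite sqr -expr2.
under [in RHS]eq_bigr => T _ do rewrite sqr -expr2.
rewrite (reindex_inj (inv_inj (swap_nextK j))) /=.
rewrite [X in _ = X + _](reindex_inj (inv_inj (swap_nextK j))) /= -big_split /=.
apply: eq_bigr => T _; rewrite swap_nextK can_lower_swap.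
rewrite -[in can_raise j (swap_next j T)]can_lower_swap swap_nextK /can_raise /can_lower.
by case: (_ \in T); case: (_ \in T) => /=; ring.
Qed.

Definition level (k s : nat) : {set {set 'I_n.+1}} :=
  [set S : {set 'I_n.+1} | (#|S| == k) && (subset_sum S == s)].

(** A matrix with rows indexed by A, columns by B and trivial left kernel has rank #|A|. *)
Lemma leq_card_kernel (F : fieldType) (T : finType) (A B : {set T}) (M : T -> T -> F) :
    (forall f : T -> F, (forall x, x \notin A -> f x = 0) ->
       (forall y, y \in B -> \sum_(x in A) f x * M x y = 0) -> forall x, f x = 0) ->
  (#|A| <= #|B|)%N.
Proof.
move=> inj.
pose N : 'M[F]_(#|A|, #|B|) := \matrix_(i, j) M (enum_val i) (enum_val j).
suff: row_free N by rewrite /row_free => /eqP {1}<-; exact: rank_leq_col.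
apply: inj_row_free => v vN0.
pose f x := \sum_(i | enum_val i == x) v 0 i.
have fE i : f (enum_val i) = v 0 i.
  rewrite /f (bigD1 i) //= big1 ?addr0 // => j /andP[/eqP /enum_val_inj -> /eqP //].
have f0 : forall x, f x = 0.
  apply: inj => [x xA|y yB].
    by rewrite /f big1 // => i /eqP ix; rewrite -ix enum_valP in xA.
  rewrite big_enum_val /=; move/matrixP/(_ 0 (enum_rank_in yB y)): vN0.
  rewrite !mxE => {2}<-; apply: eq_bigr => i _.
  by rewrite !mxE fE enum_rankK_in.
by apply/rowP => i; rewrite mxE -fE f0.
Qed.

(* Subsets index a basis of the k-th exterior power of the irreducible
   sl_2-module of dimension n + 1; with square-root weights the raising and
   lowering operators are adjoint to each other. *)
Lemma level_leq k s : (2 * s < k * n)%N -> (#|level k s| <= #|level k s.+1|)%N.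
Proof.
move=> small.
pose R := (realalg : rcfType).
pose c j : R := Num.sqrt (j.+1 * (n - j))%:R.
pose M S T : R := \sum_j c j * (can_lower j T)%:R * (S == swap_next j T)%:R.
apply: (@leq_card_kernel R _ _ _ M) => f f0 fker.
have ker T : \sum_j c j * (can_lower j T)%:R * f (swap_next j T) = 0.
  have [TB|TB] := boolP (T \in level k s.+1); last first.
    apply: big1 => j _; have [low|] := boolP (can_lower j T); last by rewrite mulr0 mul0r.
    rewrite f0 ?mulr0 //; apply: contra TB; rewrite !inE card_swap_next.
    by case/andP=> -> /eqP <-; rewrite (subset_sum_swap low) /=.
  rewrite -{2}(fker T TB) /M.
  under [RHS]eq_bigr => S _ do rewrite mulr_sumr.
  rewrite exchange_big; apply: eq_bigr => j _ /=.
  have [SA|SA] := boolP (swap_next j T \in level k s).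
    rewrite (bigD1 (swap_next j T)) //= eqxx big1; first by rewrite mulr1 addr0 mulrC.
    by move=> S /andP[_ /negbTE ->]; rewrite !mulr0.
  rewrite (f0 _ SA) mulr0 big1 // => S SA'.
  by case: eqP SA' SA => [-> ->|_ _ _] //; rewrite !mulr0.
(* As f is in the kernel, the left side is 0, while both sums on the right are nonnegative: on the
   level the weight [w] is kn - 2s > 0. So f vanishes. *)
have := sum_raise_lower f c.
rewrite big1 => [|T _]; last by rewrite ker expr0n.
pose w T := \sum_j c j ^+ 2 * ((pos j \in T)%:R - (nxt j \in T)%:R).
have wE T : w T = (#|T| * n)%:R - 2 * (subset_sum T)%:R.
  (* Summation by parts: c_j^2 = e(j + 1), the differences e(i + 1) - e(i) are n - 2i, and e
     vanishes at 0 and n + 1. *)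
  pose e (i : nat) : R := (i * (n.+1 - i))%:R.
  have -> : w T = \sum_(i < n) e i.+1 * (pos i \in T)%:R - \sum_(i < n) e i.+1 * (nxt i \in T)%:R.
    rewrite /w -sumrB; apply: eq_bigr => i _.
    by rewrite sqr_sqrtr ?ler0n // mulrBr.
  have -> : \sum_(i < n) e i.+1 * (pos i \in T)%:R = \sum_(i < n.+1) e i.+1 * (i \in T)%:R.
    by rewrite [RHS]big_ord_recr /= (_ : e n.+1 = 0) ?mul0r ?addr0 // /e subnn muln0.
  have -> : \sum_(i < n) e i.+1 * (nxt i \in T)%:R = \sum_(i < n.+1) e i * (i \in T)%:R.
    by rewrite [RHS]big_ord_recl /= (_ : e 0%N = 0) ?mul0r ?add0r // /e mul0n.
  rewrite -sumrB -sum1_card /subset_sum big_distrl /= !natr_sum mulr_sumr -sumrB.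
  rewrite [RHS]big_mkcond; apply: eq_bigr => i _; case: (i \in T); rewrite ?mulr0 ?subrr //.
  rewrite !mulr1 /e mul1n subSS.
  have := ltn_ord i; rewrite ltnS => lein.
  rewrite !natrM (natrB _ lein) (natrB _ (leqW lein)) -[i.+1%:R]natr1 -[n.+1%:R]natr1; ring.
move=> /esym /eqP; rewrite paddr_eq0; last 2 first.
- by apply: sumr_ge0 => T _; rewrite sqr_ge0.
- apply: sumr_ge0 => T _; rewrite -/(w T).
  have [|TA] := boolP (T \in level k s); last by rewrite f0 // expr0n mulr0.
  rewrite inE => /andP[/eqP cT /eqP sT]; rewrite mulr_ge0 ?sqr_ge0 // wE cT sT.
  by rewrite -natrM subr_ge0 ler_nat ltnW.
case/andP=> _; rewrite psumr_eq0 => [/allP all0 S|T _]; last first.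
  rewrite -/(w T).
  have [|TA] := boolP (T \in level k s); last by rewrite f0 // expr0n mulr0.
  rewrite inE => /andP[/eqP cT /eqP sT]; rewrite mulr_ge0 ?sqr_ge0 // wE cT sT.
  by rewrite -natrM subr_ge0 ler_nat ltnW.
have [SA|] := boolP (S \in level k s); last exact: f0.
have := all0 S (mem_index_enum _); rewrite /= -/(w S) mulf_eq0 sqrf_eq0 => /orP[|/eqP //].
move: SA; rewrite inE => /andP[/eqP cT /eqP sT].
by rewrite wE cT sT -natrM subr_eq0 eqr_nat => /eqP; lia.
Qed.

Lemma card_level_rev k s : (s <= k * n)%N -> #|level k s| = #|level k (k * n - s)|.
Proof.
move=> le_s; pose r S := [set rev_ord i | i in S].
have rK : involutive r.
  move=> S; rewrite /r -imset_comp -[RHS]imset_id.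
  by apply: eq_imset => i /=; exact: rev_ordK.
have cr S : #|r S| = #|S| by rewrite card_imset //; exact: rev_ord_inj.
have sr S : (subset_sum (r S) + subset_sum S = #|S| * n)%N.
  rewrite /subset_sum big_imset /=; last by move=> x y _ _; apply: rev_ord_inj.
  rewrite -big_split /= -sum1_card big_distrl; apply: eq_bigr => i _.
  by rewrite /= subSS subnK ?mul1n // -ltnS.
rewrite -(card_preimset _ (inv_inj rK)); apply: eq_card => S.
rewrite !inE cr; case: eqP => //= cS; have := sr S; rewrite cS => <-.
by apply/eqP/eqP; have := sr S; rewrite cS; lia.
Qed.

Lemma level_geq k s : (k * n < 2 * s.+1)%N -> (#|level k s.+1| <= #|level k s|)%N.
Proof.
move=> large; have [ltks|leks] := ltnP (k * n) s.+1.
  suff -> : level k s.+1 = set0 by rewrite cards0.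
  apply/setP => S; rewrite !inE; apply/negP => /andP[/eqP cS /eqP sS].
  move: ltks; rewrite -sS -cS -sum1_card big_distrl /= ltnNge => /negP; apply.
  by apply: leq_sum => i _; rewrite mul1n -ltnS.
rewrite (card_level_rev leks) (card_level_rev (ltnW leks)).
have -> : (k * n - s = (k * n - s.+1).+1)%N by lia.
by apply: level_leq; lia.
Qed.

End Unimodality.

(** * The polynomial Cat_q(a,b) *)

Lemma qintE n : qint n = \sum_(i < n) 'X^i.
Proof. by rewrite /qint poly_def; apply: eq_bigr => i _; rewrite scale1r. Qed.

Lemma qint_sub1 n : 'X^n - 1 = ('X - 1) * qint n.
Proof. by rewrite qintE subrX1. Qed.

Lemma qintD m n : qint (m + n) = qint m + 'X^m * qint n.
Proof.
rewrite !qintE big_split_ord /= mulr_sumr; congr (_ + _).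
by apply: eq_bigr => i _; rewrite exprD.
Qed.

Lemma qintM m n : qint (m * n) = qint m * \sum_(i < n) 'X^(m * i).
Proof.
elim: n => [|n IHn]; first by rewrite muln0 big_ord0 mulr0 qintE big_ord0.
by rewrite mulnSr qintD IHn big_ord_recr /= mulrDr [_ * qint m]mulrC.
Qed.

Lemma qint_eq0 n : (qint n == 0) = (n == 0%N).
Proof.
case: n => [|n]; first by rewrite qintE big_ord0 !eqxx.
apply/eqP => /(congr1 (fun p : {poly algC} => p`_0)).
by move/eqP; rewrite coef_poly coef0 oner_eq0.
Qed.

Lemma qint_at0 n : (qint n.+1).[0] = 1.
Proof. by rewrite horner_coef0 coef_poly. Qed.

Lemma qfactS n : qfact n.+1 = qfact n * qint n.+1.
Proof. by rewrite /qfact big_nat_recr. Qed.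

Lemma qfact_neq0 n : qfact n != 0.
Proof.
elim: n => [|n IHn]; first by rewrite /qfact big_nil oner_eq0.
by rewrite qfactS mulf_neq0 // qint_eq0.
Qed.

Lemma qfact_at0 n : (qfact n).[0] = 1.
Proof.
elim: n => [|n IHn]; first by rewrite /qfact big_nil hornerE.
by rewrite qfactS hornerM IHn qint_at0 mulr1.
Qed.

(** The outer variable marks the size of a subset of [0, n), the inner one its sum. By the
    q-binomial theorem this is q^C(k,2) times the Gaussian coefficient, which ties the levels above
    to [qbinom]. *)
Definition subset_gf (n k : nat) : {poly algC} :=
  (\prod_(i < n) ('X^i *: 'X + 1) : {poly {poly algC}})`_k.

Lemma subset_gfS n k :
  subset_gf n.+1 k.+1 = subset_gf n k.+1 + 'X^n * subset_gf n k.
Proof.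
rewrite /subset_gf big_ord_recr /= mulrDr mulr1 coefD addrC; congr (_ + _).
by rewrite -scalerAr coefZ coefMX.
Qed.

Lemma subset_gf0 n : subset_gf n 0 = 1.
Proof.
elim: n => [|n IHn]; first by rewrite /subset_gf big_ord0 coef1.
rewrite -IHn /subset_gf big_ord_recr /= mulrDr mulr1 coefD.
by rewrite -scalerAr coefZ coefMX mulr0 add0r.
Qed.

Lemma subset_gf_gt n k : (n < k)%N -> subset_gf n k = 0.
Proof.
elim: n k => [|n IHn] [|k] //; first by rewrite /subset_gf big_ord0 coef1.
by rewrite ltnS subset_gfS => ltnk; rewrite !IHn ?mulr0 ?addr0 // ltnW.
Qed.

Lemma coef_subset_gf n k s : (subset_gf n.+1 k)`_s = #|level n k s|%:R.
Proof.
rewrite /subset_gf bigA_distr coef_sum coef_sum /level -sum1dep_card natr_sum.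
rewrite [RHS]big_mkcond /=; apply: eq_bigr => S _.
rewrite -big_mkcond /= scaler_prod -expr_sum prodr_const coefZ coefXn.
rewrite -/(subset_sum S) [k == _]eq_sym; case: eqP => _; last by rewrite mulr0 coef0.
by rewrite mulr1 coefXn eq_sym; case: eqP.
Qed.

Lemma subset_gf_qfact n k : (k <= n)%N ->
  subset_gf n k * (qfact k * qfact (n - k)) = 'X^'C(k, 2) * qfact n.
Proof.
elim: n k => [|n IHn] [|k] //.
- by rewrite subset_gf0 /qfact !big_nil !mulr1.
- by move=> _; rewrite subset_gf0 subn0 /qfact big_nil !mul1r.
rewrite ltnS => lekn; rewrite subset_gfS subSS mulrDl.
have -> : 'X^n * subset_gf n k * (qfact k.+1 * qfact (n - k)) =
    'X^n * qint k.+1 * 'X^'C(k, 2) * qfact n.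
  by rewrite -!mulrA -IHn // qfactS; ring.
have eqC : 'C(k.+1, 2) = ('C(k, 2) + k)%N by rewrite binS bin1 addnC.
have -> : subset_gf n k.+1 * (qfact k.+1 * qfact (n - k)) =
    qint (n - k) * ('X^'C(k.+1, 2) * qfact n).
  move: lekn; rewrite leq_eqVlt => /orP[/eqP ->|ltkn].
    by rewrite subnn subset_gf_gt // qintE big_ord0 !mul0r.
  by rewrite -IHn // -(subnSK ltkn) !qfactS; ring.
have -> : 'X^n = 'X^k * 'X^(n - k) :> {poly algC} by rewrite -exprD subnKC.
have -> : qfact n.+1 = qfact n * (qint (n - k) + 'X^(n - k) * qint k.+1).
  by rewrite qfactS -qintD addnS subnK.
by rewrite eqC exprD; ring.
Qed.

(** The quotient is exact: the divisor divides q^C(k,2) times [qfact n] and, having constant term 1,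
    is coprime to q. *)
Lemma qbinom_qfact n k : (k <= n)%N ->
  qbinom n k * (qfact k * qfact (n - k)) = qfact n.
Proof.
move=> lekn; apply: divpK.
have cop : coprimep (qfact k * qfact (n - k)) ('X^'C(k, 2)).
  apply: coprimep_expr; rewrite coprimepX rootE hornerM !qfact_at0 mulr1.
  exact: oner_neq0.
by rewrite -(Gauss_dvdpr _ cop) -subset_gf_qfact // dvdp_mulIr.
Qed.

Lemma qbinom_subset_gf n k : (k <= n)%N ->
  'X^'C(k, 2) * qbinom n k = subset_gf n k.
Proof.
move=> lekn; have nz : qfact k * qfact (n - k) != 0 by rewrite mulf_neq0 ?qfact_neq0.
by apply: (mulIf nz); rewrite -mulrA qbinom_qfact // subset_gf_qfact.
Qed.

Lemma qbinomDSn m n :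
  qbinom (m.+1 + n) n * qint m.+1 = qint (m.+1 + n) * qbinom (m + n) n.
Proof.
have nz : qfact n * qfact m != 0 by rewrite mulf_neq0 ?qfact_neq0.
apply: (mulIf nz).
have := @qbinom_qfact (m.+1 + n) n (leq_addl _ _).
have := @qbinom_qfact (m + n) n (leq_addl _ _).
rewrite !addnK !addSn !qfactS => E1 E2.
by transitivity (qint (m + n).+1 * qfact (m + n)); [rewrite [RHS]mulrC -E2; ring|rewrite -E1; ring].
Qed.

Lemma qbinomDnS m n :
  qbinom (m + n.+1) n.+1 * qint n.+1 = qint (m + n.+1) * qbinom (m + n) n.
Proof.
have nz : qfact n * qfact m != 0 by rewrite mulf_neq0 ?qfact_neq0.
apply: (mulIf nz).
have := @qbinom_qfact (m + n.+1) n.+1 (leq_addl _ _).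
have := @qbinom_qfact (m + n) n (leq_addl _ _).
rewrite !addnK !addnS !qfactS => E1 E2.
by transitivity (qint (m + n).+1 * qfact (m + n)); [rewrite [RHS]mulrC -E2; ring|rewrite -E1; ring].
Qed.

Lemma qint_prim_root (zeta : algC) m k i : m.-primitive_root zeta ->
  (qint (m * k + i)).[zeta] = (qint (m * k)).[zeta] + (qint i).[zeta].
Proof.
by move=> prim; rewrite qintD hornerD hornerM hornerXn exprM (prim_expr_order prim) expr1n mul1r.
Qed.

Lemma horner_qint_root (zeta : algC) m i : m.-primitive_root zeta -> (1 < m)%N ->
  ((qint i).[zeta] == 0) = (m %| i)%N.
Proof.
move=> prim m1; have z1 : zeta != 1.
  by apply: contraL m1 => /eqP z1; rewrite -leqNgt dvdn_leq // (prim_order_dvd prim) z1 expr1n.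
have := congr1 (horner^~ zeta) (qint_sub1 i); rewrite !hornerE => E.
by rewrite (prim_order_dvd prim) -[RHS]subr_eq0 E mulf_eq0 subr_eq0 (negbTE z1).
Qed.

(** Induction along the ratio of consecutive q-binomials. If m does not divide i + 1, then
    [mk + i + 1] and [i + 1] have the same nonzero value at zeta and cancel. If it does, [m] must be
    cancelled in the polynomials before evaluating, which leaves the ratio (k + j) / j. *)
Lemma horner_qbinom_root (zeta : algC) m k i : m.-primitive_root zeta ->
  (qbinom (m * k + i) i).[zeta] = 'C(k + i %/ m, k)%:R.
Proof.
move=> prim; have m0 := prim_order_gt0 prim.
have zm j : zeta ^+ (m * j) = 1 by rewrite exprM (prim_expr_order prim) expr1n.
elim: i => [|i IHi].
  have -> : qbinom (m * k + 0) 0 = 1.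
    by have := qbinom_subset_gf (leq0n (m * k + 0)); rewrite subset_gf0 bin_small // mul1r.
  by rewrite div0n addn0 binn hornerE.
have rec := qbinomDnS (m * k) i.
have [/dvdnP[j def_i]|ndvd] := boolP (m %| i.+1)%N; last first.
  have m1 : (1 < m)%N by rewrite ltn_neqAle m0 andbT; apply: contra ndvd => /eqP <-; exact: dvd1n.
  move/(congr1 (horner^~ zeta)): rec; rewrite !hornerM qint_prim_root //.
  have -> : (qint (m * k)).[zeta] = 0 by apply/eqP; rewrite (horner_qint_root _ prim m1) dvdn_mulr.
  rewrite add0r mulrC.
  rewrite -(horner_qint_root _ prim m1) in ndvd.
  move/(mulfI ndvd) => ->; rewrite IHi divnS //.
  by rewrite -(horner_qint_root _ prim m1) (negbTE ndvd).
have j0 : (0 < j)%N by case: j def_i.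
move: rec; rewrite {3 4}def_i (mulnC j m) -mulnDr !qintM => rec.
have {}rec : qbinom (m * k + i.+1) i.+1 * (\sum_(l < j) 'X^(m * l)) =
    (\sum_(l < k + j) 'X^(m * l)) * qbinom (m * k + i) i.
  have nz : qint m != 0 by rewrite qint_eq0 -lt0n.
  by apply: (mulfI nz); rewrite mulrCA rec mulrA.
have sumE l : (\sum_(h < l) 'X^(m * h)).[zeta] = l%:R.
  rewrite horner_sum -[l in RHS]card_ord -sumr_const; apply: eq_bigr => h _.
  by rewrite hornerXn zm.
move/(congr1 (horner^~ zeta)): rec; rewrite !hornerM !sumE IHi.
have -> : (i %/ m = j.-1)%N by rewrite -[i]/(i.+1.-1) def_i; case: j j0 {def_i} => // j _; nia.
rewrite def_i mulnK // -natrM.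
have -> : ((k + j) * 'C(k + j.-1, k) = 'C(k + j, k) * j)%N.
  have -> : (k + j.-1 = (k + j).-1)%N by lia.
  by rewrite mul_bin_down addKn mulnC.
by rewrite natrM; apply: mulIf; rewrite pnatr_eq0 -lt0n.
Qed.

(** As [a+b] divides the q-binomial times [b], it suffices that [a+b] and [b] are coprime. A common
    root would satisfy zeta^a = zeta^b = 1, hence be 1, where [b] takes the value b. *)
Lemma qint_dvd_qbinom a b : coprime a b -> (0 < b)%N -> qint (a + b) %| qbinom (a + b) a.
Proof.
case: b => // b cop _.
have cop_ints : coprimep (qint (a + b.+1)) (qint b.+1).
  apply/Pdiv.ClosedField.coprimepP => zeta /rootP root_ab; apply/negP => /eqP root_b.
  have pow j : (qint j).[zeta] = 0 -> zeta ^+ j = 1.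
    move=> rj; have := congr1 (horner^~ zeta) (qint_sub1 j).
    by rewrite !hornerE rj mulr0 => /eqP; rewrite subr_eq0 => /eqP.
  have zb := pow _ root_b; have := pow _ root_ab; rewrite exprD zb mulr1 => za.
  have z1 : zeta = 1.
    have [u v Euv _] := egcdnP a (ltn0Sn b).
    have := congr1 (GRing.exp zeta) Euv.
    rewrite gcdnC (eqP cop) exprD mulnC exprM zb expr1n mulnC exprM za expr1n mul1r expr1.
    by move=> ->.
  have := root_b; rewrite z1 qintE horner_sum.
  under eq_bigr => i _ do rewrite hornerXn expr1n.
  by rewrite sumr_const card_ord => /eqP; rewrite pnatr_eq0.
rewrite -(Gauss_dvdpl _ cop_ints) [(a + _)%N]addnC qbinomDSn.
by apply: dvdp_mulr; apply: dvdpp.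
Qed.

Lemma qCat_qint a b : coprime a b -> (0 < b)%N -> qCat a b * qint (a + b) = qbinom (a + b) a.
Proof. by move=> cop b0; apply: divpK; apply: qint_dvd_qbinom. Qed.

Lemma qCat_qint_r a n : coprime a n.+1 -> qCat a n.+1 * qint n.+1 = qbinom (n + a) a.
Proof.
move=> cop; have nz : qint (a + n.+1) != 0 by rewrite qint_eq0 addnS.
apply: (mulIf nz); rewrite mulrAC (qCat_qint cop) // [(a + _)%N]addnC.
by rewrite qbinomDSn mulrC.
Qed.

(** The factor next to [qCat] is the value of [n + 1] at zeta: since m divides n, only [1] survives
    when m > 1. *)
Lemma horner_qCat a n k m (zeta : algC) : coprime a n.+1 -> n = (m * k)%N ->
    m.-primitive_root zeta ->
  (qCat a n.+1).[zeta] * (if m == 1 then n.+1 else 1)%:R = 'C(k + a %/ m, k)%:R.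
Proof.
move=> cop def_n prim; rewrite -(horner_qbinom_root _ _ prim) -def_n -qCat_qint_r // hornerM.
congr (_ * _); have [m1|m1] := eqVneq m 1%N.
  have z1 : zeta = 1 by have := prim_expr_order prim; rewrite m1 expr1.
  rewrite z1 qintE horner_sum; under eq_bigr => i _ do rewrite hornerXn expr1n.
  by rewrite sumr_const card_ord.
rewrite -addn1 def_n qint_prim_root //.
have m_gt1 : (1 < m)%N by rewrite ltn_neqAle eq_sym m1 (prim_order_gt0 prim).
have /eqP -> : (qint (m * k)).[zeta] == 0 by rewrite (horner_qint_root _ prim m_gt1) dvdn_mulr.
by rewrite qintE big_ord1 expr0 !hornerE.
Qed.

(* With F = q^C(a,2) Cat_q(a,b) and G the generating function of the a-subsets
   of [0, a + b) by sum, F (1 - q^(a+b)) = G (1 - q).  On the increasing half of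
   the coefficients of G this gives F_t >= F_(t-a-b), on the decreasing half
   F_t >= F_(t+a+b). *)
Lemma qCat_nat a b : coprime a b -> (0 < b)%N -> (0 < a)%N -> qCat a b \is a polyOver Num.nat.
Proof.
move=> cop b0 a0; have [n def_n] : exists n, (a + b = n.+1)%N by exists (a + b).-1; lia.
pose F := 'X^'C(a, 2) * qCat a b.
have EF : F * (1 - 'X^(n.+1)) = subset_gf n.+1 a * (1 - 'X).
  rewrite -def_n -qbinom_subset_gf ?leq_addr // -qCat_qint //.
  by rewrite -[1 - 'X^_]opprB qint_sub1 /F; ring.
have coefF t : F`_t - (if (t < n.+1)%N then 0 else F`_(t - n.+1)) =
    #|level n a t|%:R - (if t == 0%N then 0 else #|level n a t.-1|%:R).
  have := congr1 (fun p : {poly algC} => p`_t) EF.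
  rewrite !mulrBr !mulr1 !coefB coefMXn coefMX coef_subset_gf => ->.
  by case: eqP => // _; rewrite coef_subset_gf.
have up t : (2 * t <= (a * n).+1)%N -> F`_t \is a Num.nat.
  elim/ltn_ind: t => t IHt small.
  have -> : F`_t = (if (t < n.+1)%N then 0 else F`_(t - n.+1)) +
      (#|level n a t|%:R - (if t == 0%N then 0 else #|level n a t.-1|%:R)).
    by rewrite -coefF addrC subrK.
  rewrite rpredD //; first by case: ifP => [_|lt]; [exact: rpred0|apply: IHt; lia].
  case: t small {IHt} => [|t] small /=; first by rewrite subr0 natr_nat.
  by rewrite -natrB ?natr_nat // level_leq //; lia.
(* Descending induction: [d] bounds the distance from t to the size of F, past which the
   coefficients are zero. *)
have down d t : (size F <= t + d)%N -> (a * n < 2 * (t + n.+1))%N -> F`_t \is a Num.nat.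
  elim/ltn_ind: d t => d IHd t small large.
  have [d0|d0] := posnP d.
    by move: small; rewrite d0 addn0 => small; rewrite nth_default ?rpred0.
  have -> : F`_t = F`_(t + n.+1) + (#|level n a (t + n)|%:R - #|level n a (t + n).+1|%:R).
    have := coefF (t + n.+1)%N; rewrite addnK ifF; last by lia.
    by rewrite ifF ?addnS //= => E; rewrite -opprB -E; ring.
  rewrite rpredD //; first by apply: (IHd d.-1); lia.
  by rewrite -natrB ?natr_nat // level_geq //; lia.
have Fnat t : F`_t \is a Num.nat.
  have [small|large] := leqP (2 * t) (a * n).+1; first exact: up.
  by apply: (down (size F)); lia.
apply/polyOverP => t; have := Fnat (t + 'C(a, 2))%N.
by rewrite /F coefXnM addnK ifF //; lia.
Qed.

(** * Profiles of Dyck paths *)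

(** The group generated by s is a q-group, so its number of fixed points is congruent to #|T| modulo
    q. *)
Lemma prime_order_fixpoint (T : finType) (s : {perm T}) q :
  prime q -> (s ^+ q)%g = 1%g -> ~~ (q %| #|T|)%N -> exists x, s x = x.
Proof.
move=> q_pr sq ndvd.
have q_group : pgroup q <[s]>%g.
  apply: (pnat_dvd (n := q)); last by rewrite pnat_id.
  by rewrite order_dvdn sq.
have acts : [acts <[s]>%g, on [set: T] | 'P].
  by apply/actsP => x _ y; rewrite !inE.
have := pgroup_fix_mod q_group acts; rewrite cardsT => fix_mod.
have [fix0|[x]] := set_0Vmem ('Fix_([set: T] | 'P)(<[s]>))%g.
  by move: ndvd fix_mod; rewrite fix0 cards0 mod0n /dvdn => /negbTE nd /eqP; rewrite nd.
by rewrite inE => /andP[_ /afixP fix_x]; exists x; apply: (fix_x s (cycle_id s)).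
Qed.

Section Profiles.
Variable n : nat.
Implicit Types g h : nat -> int.

Definition step g (c : nat) : int := g c.+1 - g c.

(** Only these traits of g are kept. Nothing is asked of the steps, so that the class is closed
    under reversal, although a reversed profile need not come from a Dyck path. *)
Definition profile g : Prop :=
  [/\ g 0%N = 0, g n.+1 = 0, forall i, (0 < i <= n)%N -> 0 < g i &
      forall i j, (i <= n)%N -> (j <= n)%N -> g i = g j -> i = j].

Definition lo g (i : nat) : nat := \max_(c < i | g c < g i) c.

(** The line of slope a/b from label i next meets the path on the east step [hi g i], so this is
    where a laser ends. A label with an empty run is its own [hi]. *)
Definition hi g (i : nat) : nat :=
  find (fun c => (i <= c)%N && (g c.+1 < g i)) (iota 0 n.+1).

Lemma lo_spec g i : profile g -> (0 < i <= n)%N ->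
  [/\ (lo g i < i)%N, g (lo g i) < g i & forall j, (lo g i < j < i)%N -> g i < g j].
Proof.
case=> g0 gn pos inj /andP[i0 lein].
have [|[c /= ltci] gc loE] := @eq_bigmax_cond _ [pred c : 'I_i | g c < g i] val.
  by apply/card_gt0P; exists (Ordinal i0); rewrite inE /= g0 pos ?i0.
have {}loE : lo g i = c by exact: loE.
rewrite loE; split=> // j /andP[ltcj ltji].
rewrite lt_neqAle leNgt; apply/andP; split.
  by apply/eqP => /inj; lia.
apply/negP => gji; suff : (j <= lo g i)%N by rewrite loE; lia.
exact: (@leq_bigmax_cond _ [pred c : 'I_i | g c < g i] val (Ordinal ltji)).
Qed.

Lemma hi_spec g i : profile g -> (0 < i <= n)%N ->
  [/\ (i <= hi g i <= n)%N, g (hi g i).+1 < g i & forall j, (i < j <= hi g i)%N -> g i < g j].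
Proof.
case=> g0 gn pos inj /andP[i0 lein].
set P := fun c => (i <= c)%N && (g c.+1 < g i).
have hasP : has P (iota 0 n.+1).
  by apply/hasP; exists n; [rewrite mem_iota /=; lia|rewrite /P lein gn pos ?i0].
have lt_hi : (hi g i < n.+1)%N by move: hasP; rewrite has_find size_iota.
have := nth_find 0%N hasP; rewrite -/(hi g i) nth_iota // add0n /P => /andP[le_hi g_hi].
split=> //; first by rewrite le_hi.
move=> j /andP[ltij lejh]; rewrite lt_neqAle leNgt; apply/andP; split.
  by apply/eqP => /inj; lia.
have ltj : (j.-1 < hi g i)%N by lia.
have := before_find 0%N ltj; rewrite nth_iota; last by lia.
rewrite add0n prednK; last by lia.
by case: ltrP; rewrite ?andbF // andbT => _; lia.
Qed.

Lemma loE g i c : profile g -> (0 < i <= n)%N -> (c < i)%N -> g c < g i ->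
  (forall j, (c < j < i)%N -> g i <= g j) -> lo g i = c.
Proof.
move=> pg ir ltci gc above; have [l1 l2 l3] := lo_spec pg ir.
case: (ltngtP (lo g i) c) => // lt.
  by have := l3 c; rewrite lt ltci => /(_ isT); lia.
by have := above (lo g i); rewrite lt l1 => /(_ isT); lia.
Qed.

Lemma hiE g i c : profile g -> (0 < i <= n)%N -> (i <= c <= n)%N -> g c.+1 < g i ->
  (forall j, (i < j <= c)%N -> g i <= g j) -> hi g i = c.
Proof.
move=> pg ir rc gc above; have [l1 l2 l3] := hi_spec pg ir.
case: (ltngtP (hi g i) c) => // lt.
  by have := above (hi g i).+1 ; rewrite lt => H; have := H ltac:(lia); lia.
by have := l3 c.+1; move=> H; have := H ltac:(lia); lia.
Qed.

(** The P-block at position c has least label c + 1 and, by [step_hi], the Q-block at c has greatest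
    label c. Hence v_(min - 1) and v_max are both the run v_c. *)
Lemma step_lo g i : profile g -> (0 < i <= n)%N ->
  lo g (lo g i).+1 = lo g i /\ 0 < step g (lo g i).
Proof.
move=> pg ir; have [l1 l2 l3] := lo_spec pg ir.
have up : g (lo g i) < g (lo g i).+1.
  case: (ltngtP (lo g i).+1 i) => [lt|lt|->] //; last by lia.
  by have := l3 (lo g i).+1; rewrite ltnSn lt => /(_ isT); lia.
split; last by rewrite /step; lia.
by apply: loE => //; [lia|move=> j; lia].
Qed.

Lemma step_hi g i : profile g -> (0 < i <= n)%N ->
  hi g (hi g i) = hi g i /\ step g (hi g i) < 0.
Proof.
move=> pg ir; have [/andP[l1 l1'] l2 l3] := hi_spec pg ir.
have down : g (hi g i).+1 < g (hi g i).
  case: (ltngtP i (hi g i)) => [lt|lt|eq_i]; [|lia|by move: l2; rewrite -eq_i].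
  by have := l3 (hi g i); rewrite leqnn lt => /(_ isT); lia.
split; last by rewrite /step; lia.
by apply: hiE => //; [lia|lia|move=> j; lia].
Qed.

Lemma lo_step_pos g c : profile g -> (c < n)%N -> 0 < step g c -> lo g c.+1 = c.
Proof. by rewrite /step => pg ltcn up; apply: loE => //; [lia|move=> j; lia]. Qed.

Lemma hi_step_neg g c : profile g -> (0 < c <= n)%N -> step g c < 0 -> hi g c = c.
Proof. by rewrite /step => pg ltcn up; apply: hiE => //; [lia|lia|move=> j; lia]. Qed.

(** * Rotation of the labels 1, ..., n *)

Definition shift (t i : nat) : nat := ((i.-1 + t) %% n).+1.

Lemma shift_range t i : (0 < n)%N -> (0 < shift t i <= n)%N.
Proof. by move=> n0; rewrite /shift ltn_mod. Qed.

Lemma shiftE t i : (0 < i <= n)%N -> (t <= n)%N ->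
  shift t i = if (i + t <= n)%N then (i + t)%N else (i + t - n)%N.
Proof.
move=> ir tn; rewrite /shift; case: leqP => le.
  by rewrite modn_small; lia.
have -> : (i.-1 + t = i + t - n.+1 + n)%N by lia.
by rewrite modnDr modn_small; lia.
Qed.

(** Expresses without set partitions that t rotations carry the labeled pair of g to that of h:
    steps encode ranks, and labels share a block when their positions agree. See
    [shift_similarP]. *)
Definition shift_similar (t : nat) g h : Prop :=
  forall i, (0 < i <= n)%N ->
  [/\ step h (lo h (shift t i)) = step g (lo g i),
      step h (hi h (shift t i)) = step g (hi g i),
      forall j, (0 < j <= n)%N ->
        (lo h (shift t i) == lo h (shift t j)) = (lo g i == lo g j) &
      forall j, (0 < j <= n)%N ->
        (hi h (shift t i) == hi h (shift t j)) = (hi g i == hi g j)].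

(** Here [rho] is the map of vertices that accompanies the rotation of the edges. *)
Lemma shift_similarI t g h (rho : nat -> nat) : profile g ->
    (forall c d, (c <= n)%N -> (d <= n)%N -> rho c = rho d -> c = d) ->
    (forall c, (c <= n)%N -> step h (rho c) = step g c) ->
    (forall i, (0 < i <= n)%N -> lo h (shift t i) = rho (lo g i)) ->
    (forall i, (0 < i <= n)%N -> hi h (shift t i) = rho (hi g i)) ->
  shift_similar t g h.
Proof.
move=> pg inj rhoS rho_lo rho_hi i ir.
have lon j : (0 < j <= n)%N -> (lo g j <= n)%N by move=> jr; have [] := lo_spec pg jr; lia.
have hin j : (0 < j <= n)%N -> (hi g j <= n)%N by move=> jr; have [] := hi_spec pg jr; lia.
rewrite rho_lo // rho_hi // !rhoS ?lon ?hin //; split=> // j jr.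
  by rewrite rho_lo //; apply/eqP/eqP => [/inj ->|->] //; exact: lon.
by rewrite rho_hi //; apply/eqP/eqP => [/inj ->|->] //; exact: hin.
Qed.

(* Rotating the labels by one moves label n to 1: the vertical run starting its
   block of P becomes the first run, and leaves its place to the last run. *)
Section RotateOne.
Variables g h : nat -> int.
Hypothesis n_gt0 : (0 < n)%N.
Hypothesis prof_g : profile g.
Hypothesis h0 : h 0%N = 0.
Let p := lo g n.
Hypothesis step0 : step h 0 = step g p.
Hypothesis stepS : forall j, (j < n)%N -> j != p -> step h j.+1 = step g j.
Hypothesis step_p : step h p.+1 = step g n.

Let nr : (0 < n <= n)%N. Proof. by rewrite n_gt0 leqnn. Qed.

Lemma rotate_one_le j : (j <= p)%N -> h j.+1 = g j + step g p.
Proof.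
have [g0 _ _ _] := prof_g.
have [l1 _ _] := lo_spec prof_g nr.
elim: j => [|j IHj] lejp.
  by rewrite -step0 /step; lia.
have := stepS (j := j); rewrite /step in IHj *; rewrite -/p in l1.
by move=> H; have := H ltac:(lia) ltac:(lia); have := IHj ltac:(lia); lia.
Qed.

Lemma rotate_one_gt j : (p < j <= n)%N -> h j.+1 = g j - g n.
Proof.
have [g0 gn _ _] := prof_g.
elim: j => [//|j IHj] /andP[]; rewrite ltnS leq_eqVlt => /orP[/eqP pj lejn|ltpj lejn].
  have := step_p; have := rotate_one_le (leqnn p); rewrite -pj /step gn; lia.
have := IHj; have := stepS (j := j); rewrite /step => H1 H2.
by have := H1 ltac:(lia) ltac:(lia); have := H2 ltac:(lia); lia.
Qed.

Lemma rotate_one_ge0 j : (j <= n.+1)%N -> 0 <= h j.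
Proof.
have [g0 gn pos _] := prof_g; have [_ up] := step_lo prof_g nr.
have [l1 _ l3] := lo_spec prof_g nr.
case: j => [|j]; first by rewrite h0.
rewrite ltnS => lejn; case: (leqP j p) => [le|lt].
  rewrite rotate_one_le // -/p in up *; have : 0 <= g j; last by lia.
  by case: j lejn le => [|j] le _; [rewrite g0|apply/ltW/pos].
rewrite rotate_one_gt ?lt //; case: (ltngtP j n) lejn => // [ltjn _|-> _]; last by lia.
by have := l3 j; rewrite -/p lt ltjn => /(_ isT); lia.
Qed.

Lemma rotate_one_end : h n.+1 = 0.
Proof.
have [l1 _ _] := lo_spec prof_g nr.
by rewrite rotate_one_gt ?subrr // leqnn andbT.
Qed.

Lemma rotate_one_similar : profile h -> shift_similar 1 g h.
Proof.
move=> prof_h; have [g0 gn pos inj] := prof_g; have [_ up] := step_lo prof_g nr.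
have [l1 l2 l3] := lo_spec prof_g nr; rewrite -/p in l1 l2 l3 up.
have hle := rotate_one_le; have hgt := rotate_one_gt.
have gnn j : (j <= n)%N -> 0 <= g j.
  by case: j => [|j] le; [rewrite g0|apply/ltW/pos].
have lon i : (0 < i <= n)%N -> (i < n)%N -> (p < i)%N -> (p <= lo g i)%N.
  move=> ir ltin ltpi; have [m1 m2 m3] := lo_spec prof_g ir.
  by rewrite leqNgt; apply/negP => lt; have := m3 p; have := l3 i; lia.
(* The P-block of label n moves to the front, as it now contains label 1; the Q-block of n now has
   greatest label p + 1; every other vertex moves one place. *)
pose rho c := if c == p then 0%N else if c == n then p.+1 else c.+1.
have rhoE c : c <> p -> c <> n -> rho c = c.+1.
  by rewrite /rho => /eqP/negbTE -> /eqP/negbTE ->.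
apply: (@shift_similarI 1 g h rho) => //.
- move=> c d lec led; rewrite /rho.
  by case: (c =P p); case: (c =P n); case: (d =P p); case: (d =P n); lia.
- move=> c lec; rewrite /rho; case: eqP => [->|np] //; case: eqP => [->|nn] //.
  by apply: stepS; [lia|apply/eqP].
- move=> i ir; rewrite shiftE //; have [m1 m2 m3] := lo_spec prof_g ir.
  case: ifP => [le|gt]; last first.
    have -> : i = n by lia.
    rewrite /rho eqxx addKn; apply: loE; [done|lia|lia| |move=> j; lia].
    by rewrite h0 hle // g0; lia.
  case: (leqP i p) => [leip|ltpi].
    have -> : rho (lo g i) = (lo g i).+1 by apply: rhoE; lia.
    apply: loE; [done|lia|lia| |]; rewrite addn1 (hle i) //; first by rewrite hle; lia.
    by move=> [|j] // jr; rewrite hle; [have := m3 j; lia|lia].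
  have lon_i := lon i ir ltac:(lia) ltpi.
  have ltgn : g n < g i by apply: l3; lia.
  rewrite /rho; case: eqP => [eq_p|neq_p].
    apply: loE; [done|lia|lia| |]; rewrite addn1 (hgt i); try lia.
    move=> [|j] // jr; case: (leqP j p) => lejp; last by rewrite hgt; [have := m3 j; lia|lia].
    rewrite hle // /step; have : g i <= g p.+1.
      by case: (ltngtP p.+1 i) => [lt|lt|->] //; [apply/ltW/m3; lia|lia].
    by have := gnn j ltac:(lia); lia.
  case: eqP => [|_]; first by lia.
  apply: loE; [done|lia|lia| |]; rewrite addn1 (hgt i); try lia; first by rewrite hgt; lia.
  by move=> [|j] // jr; rewrite hgt; [have := m3 j; lia|lia].
- move=> i ir; rewrite shiftE //; have [/andP[m1 m1'] m2 m3] := hi_spec prof_g ir.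
  have gnpos : 0 < g n by apply: pos.
  case: ifP => [le|gt]; last first.
    have eq_i : i = n by lia.
    have -> : hi g i = n by lia.
    rewrite eq_i /rho eqxx addKn.
    case: eqP => [|_]; first by lia.
    apply: hiE; [done|lia|lia| |].
      by rewrite (hle 0%N) // hgt; [rewrite /step; lia|lia].
    by move=> [|j] // jr; rewrite (hle 0%N) // hle; [have := gnn j; lia|lia].
  case: (leqP i p) => [leip|ltpi].
    case: (ltngtP (hi g i) p) => [lt|lt|eq_p].
    - have -> : rho (hi g i) = (hi g i).+1 by apply: rhoE; lia.
      apply: hiE; [done|lia|lia| |]; rewrite addn1 (hle i) //; first by rewrite hle; lia.
      by move=> [|j] // jr; rewrite hle; [have := m3 j; lia|lia].
    (* After p the heights up to n are at least g n > g p >= g i, so the search from i stops only at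
       n. *)
    - have gip : g i <= g p.
        by case: (ltngtP i p) leip => // [ltip _|-> //]; apply/ltW/m3; lia.
      have hin : hi g i = n.
        case: (ltngtP (hi g i) n) => // [ltn|]; last by lia.
        have := l3 (hi g i).+1.
        by case: (ltngtP (hi g i).+1 n) => [?|?|eqn]; [lia|lia|move: m2; rewrite eqn; lia].
      rewrite hin /rho eqxx; case: eqP => [|_]; first by lia.
      apply: hiE; [done|lia|lia| |]; rewrite addn1 (hle i) //.
        by have := gnn i ltac:(lia); rewrite hgt; [rewrite /step; lia|lia].
      move=> [|j] // jr; rewrite hle; last by lia.
      by case: (ltngtP i j) => [lt'|lt'|->] //; [have := m3 j; lia|lia].
    - by move: up; rewrite /step -eq_p; have := step_hi prof_g ir; rewrite /step; lia.
  have ltgn : g n < g i by apply: l3; lia.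
  have ltn : (hi g i < n)%N.
    by rewrite ltn_neqAle m1' andbT; apply/eqP => eqn; have := m3 n; lia.
  have -> : rho (hi g i) = (hi g i).+1 by apply: rhoE; lia.
  apply: hiE; [done|lia|lia| |]; rewrite addn1 (hgt i); try lia; first by rewrite hgt; lia.
  by move=> [|j] // jr; rewrite hgt; [have := m3 j; lia|lia].
Qed.
End RotateOne.

(** * Rotation about the last vertex: cyclic shift of the first n runs *)

Section RotateAboutLast.
Variables (g h : nat -> int) (k : nat).
Hypothesis k_range : (0 < k <= n)%N.
Hypothesis prof_g : profile g.
Hypothesis h0 : h 0%N = 0.
Hypothesis stepL : forall j, (j < n - k)%N -> step h j = step g (k + j).
Hypothesis stepR : forall j, (j < k)%N -> step h (n - k + j) = step g j.

Lemma rotate_lastL j : (j <= n - k)%N -> h j = g (k + j) - g k.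
Proof.
elim: j => [|j IHj] le; first by rewrite h0 addn0 subrr.
by have := stepL le; rewrite /step IHj ?(ltnW le) // addnS; lia.
Qed.

Lemma rotate_lastR j : (j <= k)%N -> h (n - k + j) = g n - g k + g j.
Proof.
have [g0 _ _ _] := prof_g.
elim: j => [|j IHj] le.
  by rewrite addn0 rotate_lastL // g0 addr0; congr (g _ - _); lia.
by have := stepR le; rewrite /step IHj ?(ltnW le) // addnS; lia.
Qed.

(** [hi g k = n] says that g k is the least height on [k, n], which makes both pieces of h
    nonnegative. *)
Lemma rotate_last_ge0 : hi g k = n -> step h n = step g n ->
  h n.+1 = 0 /\ forall j, (j <= n)%N -> 0 <= h j.
Proof.
have [g0 gn pos _] := prof_g => hi_k step_n.
have gnn j : (j <= n)%N -> 0 <= g j.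
  by case: j => [|j] le; [rewrite g0|apply/ltW/pos].
have [_ _ min_k] := hi_spec prof_g k_range.
have le_k j : (k <= j <= n)%N -> g k <= g j.
  by case: (ltngtP k j) => [lt jr|lt|-> //]; [apply/ltW/min_k; lia|lia].
split.
  by move: step_n; have := rotate_lastR (leqnn k); rewrite subnK ?(andP k_range).2 // /step; lia.
move=> j lejn; case: (leqP j (n - k)) => [le|lt].
  by rewrite rotate_lastL // subr_ge0 le_k //; lia.
have -> : j = (n - k + (j - (n - k)))%N by lia.
by rewrite rotate_lastR; [rewrite addr_ge0 ?subr_ge0 ?gnn ?le_k //; lia|lia].
Qed.

(** Positivity of h gives back the minimality of g k, so [rotate_last_similar] may assume that h is
    a profile in place of [hi g k = n]. *)
Lemma rotate_last_min j : profile h -> (k < j <= n)%N -> g k < g j.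
Proof.
move=> [_ hn pos inj] jr; have := @rotate_lastL (j - k); rewrite subnKC; last by lia.
by have := pos (j - k)%N => H1 H2; have := H1 ltac:(lia); have := H2 ltac:(lia); lia.
Qed.

Lemma rotate_last_similar : profile h -> shift_similar (n - k) g h.
Proof.
move=> prof_h; have [g0 gn pos inj] := prof_g; have [_ hn hpos hinj] := prof_h.
have hL := rotate_lastL; have hR := rotate_lastR; have kmin j := @rotate_last_min j prof_h.
have hL' j : (k <= j <= n)%N -> h (j - k)%N = g j - g k.
  by move=> jr; rewrite hL ?subnKC //; lia.
have hR' j : (n - k <= j <= n)%N -> h j = g n - g k + g (j - (n - k))%N.
  by move=> jr; rewrite -hR ?subnKC //; lia.
have gkn : g k <= g n.
  by case: (ltngtP k n) => [lt|lt|-> //]; [apply/ltW/kmin; lia|lia].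
have gnn j : (j <= n)%N -> 0 <= g j.
  by case: j => [|j] le; [rewrite g0|apply/ltW/pos].
(* Vertex n stays, and the others turn by n - k modulo n, in step with the labels. *)
pose rho c := if c == n then n else if (c < k)%N then (n - k + c)%N else (c - k)%N.
have rho_n : rho n = n by rewrite /rho eqxx.
have rho_lt c : (c < k)%N -> (c < n)%N -> rho c = (n - k + c)%N.
  by rewrite /rho => -> lt; rewrite ltn_eqF.
have rho_ge c : (k <= c)%N -> (c < n)%N -> rho c = (c - k)%N.
  by rewrite /rho => le lt; rewrite ltn_eqF // ltnNge le.
apply: (@shift_similarI _ g h rho) => //.
- move=> c d lec led.
  by rewrite /rho; case: (c =P n); case: (d =P n); case: (ltnP c k); case: (ltnP d k); lia.
- move=> c; rewrite leq_eqVlt => /orP[/eqP ->|ltcn].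
    rewrite rho_n /step hn gn; have := hR k (leqnn k); rewrite subnK; last by lia.
    by move=> ->; lia.
  case: (ltnP c k) => [lt|le]; first by rewrite rho_lt // stepR.
  by rewrite rho_ge // stepL ?subnKC //; lia.
- move=> i ir; have [m1 m2 m3] := lo_spec prof_g ir.
  rewrite shiftE //; last by lia.
  case: (leqP i k) => [leik|ltki].
    rewrite rho_lt; try lia.
    have -> : ((if i + (n - k) <= n then i + (n - k) else i + (n - k) - n) = n - k + i)%N.
      by case: ifP; lia.
    apply: loE; [done|lia|lia| |].
      by rewrite !hR; try lia.
    by move=> j jr; rewrite hR; [rewrite hR'; [have := m3 (j - (n - k))%N; lia|lia]|lia].
  have -> : ((if i + (n - k) <= n then i + (n - k) else i + (n - k) - n) = i - k)%N.
    by case: ifP; lia.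
  have le_lo : (k <= lo g i)%N.
    by rewrite leqNgt; apply/negP => lt; have := m3 k; have := kmin i; lia.
  rewrite rho_ge; try lia.
  apply: loE; [done|lia|lia| |].
    by rewrite !hL'; try lia.
  move=> j jr; rewrite hL'; last by lia.
  by rewrite hL; [have := m3 (k + j)%N; lia|lia].
- move=> i ir; have [/andP[m1 m1'] m2 m3] := hi_spec prof_g ir.
  rewrite shiftE //; last by lia.
  case: (leqP i k) => [leik|ltki].
    have -> : ((if i + (n - k) <= n then i + (n - k) else i + (n - k) - n) = n - k + i)%N.
      by case: ifP; lia.
    case: (ltnP (hi g i) k) => [lt|le].
      rewrite rho_lt //; last by lia.
      apply: hiE; [done|lia|lia| |].
        by rewrite -addnS !hR; try lia.
      by move=> j jr; rewrite hR; [rewrite hR'; [have := m3 (j - (n - k))%N; lia|lia]|lia].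
    have gik : g i <= g k.
      by case: (ltngtP i k) leik => // [lt _|-> //]; apply/ltW/m3; lia.
    have -> : hi g i = n.
      case: (ltngtP (hi g i) n) => // [lt|]; last by lia.
      by have := kmin (hi g i).+1; lia.
    rewrite rho_n; apply: hiE; [done|lia|lia| |].
      by rewrite hn; apply: hpos; lia.
    move=> j jr; rewrite hR; last by lia.
    rewrite hR'; last by lia.
    case: (leqP (j - (n - k)) (hi g i)) => [le'|]; last by lia.
    by have := m3 (j - (n - k))%N; lia.
  have -> : ((if i + (n - k) <= n then i + (n - k) else i + (n - k) - n) = i - k)%N.
    by case: ifP; lia.
  have ltgi : g k < g i by apply: kmin; lia.
  case: (ltngtP (hi g i) n) m1' => // [lt _|eq_n _].
    rewrite rho_ge //; last by lia.
    apply: hiE; [done|lia|lia| |].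
      rewrite hL'; last by lia.
      by rewrite (_ : (hi g i - k).+1 = (hi g i).+1 - k)%N; [rewrite hL'; lia|lia].
    move=> j jr; rewrite hL'; last by lia.
    by rewrite hL; [have := m3 (k + j)%N; lia|lia].
  rewrite eq_n rho_n; apply: hiE; [done|lia|lia| |].
    by rewrite hn; apply: hpos; lia.
  have gin : g i <= g n.
    by case: (ltngtP i n) ir => [lt _|lt|-> _] //; [apply/ltW/m3; lia|lia].
  move=> j jr; rewrite hL'; last by lia.
  case: (leqP j (n - k)) => [le|lt]; first by rewrite hL; [have := m3 (k + j)%N; lia|lia].
  by rewrite hR'; [have := gnn (j - (n - k))%N; lia|lia].
Qed.
End RotateAboutLast.

(** * Reversal, which exchanges P and Q *)

Section Reversal.

Definition rev_profile g : nat -> int := fun i => g (n.+1 - i)%N.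

Lemma profile_rev g : profile g -> profile (rev_profile g).
Proof.
case=> g0 gn pos inj; rewrite /rev_profile; split.
- by rewrite subn0.
- by rewrite subnn.
- by move=> i ir; apply: pos; lia.
- move=> [|i] [|j] // lei lej; rewrite ?subn0 ?gn ?subSS.
  + by move=> E; have := pos (n - j)%N; rewrite -E; lia.
  + by move=> E; have := pos (n - i)%N; rewrite E; lia.
  + by move/inj; lia.
Qed.

Lemma step_rev g c : (c <= n)%N -> step (rev_profile g) c = - step g (n - c).
Proof. by move=> le; rewrite /step /rev_profile subSS subSn // opprB. Qed.

Lemma lo_rev g i : profile g -> (0 < i <= n)%N ->
  lo (rev_profile g) i = (n - hi g (n.+1 - i))%N.
Proof.
move=> pg ir; have [//||/andP[m1 m1'] m2 m3] := @hi_spec g (n.+1 - i); first by lia.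
apply: loE; [exact: profile_rev|lia|lia| |]; rewrite /rev_profile.
  by rewrite (_ : n.+1 - (n - hi g (n.+1 - i)) = (hi g (n.+1 - i)).+1)%N //; lia.
by move=> j jr; apply/ltW/m3; lia.
Qed.

Lemma hi_rev g i : profile g -> (0 < i <= n)%N ->
  hi (rev_profile g) i = (n - lo g (n.+1 - i))%N.
Proof.
move=> pg ir; have [//||m1 m2 m3] := @lo_spec g (n.+1 - i); first by lia.
apply: hiE; [exact: profile_rev|lia|lia| |]; rewrite /rev_profile.
  by rewrite (_ : n.+1 - (n - lo g (n.+1 - i)).+1 = lo g (n.+1 - i))%N //; lia.
by move=> j jr; apply/ltW/m3; lia.
Qed.

Lemma shift_similar_rev t g h : profile g -> profile h -> (t <= n)%N ->
  shift_similar t (rev_profile g) (rev_profile h) -> shift_similar (n - t) g h.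
Proof.
move=> pg ph letn sim i ir.
have rev_ir j : (0 < j <= n)%N -> (0 < n.+1 - j <= n)%N by lia.
have revK j : (0 < j <= n)%N -> (n.+1 - (n.+1 - j) = j)%N by lia.
have shift_rev j : (0 < j <= n)%N -> shift (n - t) j = (n.+1 - shift t (n.+1 - j))%N.
  by move=> jr; rewrite !shiftE; try lia; case: ifP; case: ifP; lia.
have sr j : (0 < j <= n)%N -> (0 < shift t (n.+1 - j) <= n)%N.
  by move=> jr; apply: shift_range; lia.
have lor f j : profile f -> (0 < j <= n)%N -> (lo f j <= n)%N.
  by move=> pf jr; have [] := lo_spec pf jr; lia.
have hir f j : profile f -> (0 < j <= n)%N -> (hi f j <= n)%N.
  by move=> pf jr; have [] := hi_spec pf jr; lia.
have cancel_sub x y : (x <= n)%N -> (y <= n)%N -> (n - x == n - y)%N = (x == y).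
  by move=> lex ley; apply/eqP/eqP; lia.
have [s1 s2 s3 s4] := sim _ (rev_ir _ ir).
rewrite shift_rev //; split.
- have := s2; rewrite !hi_rev ?rev_ir ?sr // revK // !step_rev ?leq_subr //.
  by rewrite !subKn ?lor ?rev_ir ?sr //; apply: oppr_inj.
- have := s1; rewrite !lo_rev ?rev_ir ?sr // revK // !step_rev ?leq_subr //.
  by rewrite !subKn ?hir ?rev_ir ?sr //; apply: oppr_inj.
- move=> j jr; have := s4 _ (rev_ir _ jr); rewrite shift_rev //.
  by rewrite !hi_rev ?rev_ir ?sr // !revK // !cancel_sub ?lor ?rev_ir ?sr.
- move=> j jr; have := s3 _ (rev_ir _ jr); rewrite shift_rev //.
  by rewrite !lo_rev ?rev_ir ?sr // !revK // !cancel_sub ?hir ?rev_ir ?sr.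
Qed.
End Reversal.

(** * Rotational symmetry about the last vertex *)

Section Symmetric.
Variables (g : nat -> int) (k : nat).
Hypothesis prof_g : profile g.
Hypothesis k_range : (0 < k < n)%N.
Hypothesis k_dvd : (k %| n)%N.

(** Periodicity gives g(l + j) = g(l) + g(j) for multiples l of k, so g stays above g(l) from l to
    n. *)
Lemma periodic_hi : (forall j, (k + j < n)%N -> step g (k + j) = step g j) ->
  forall l, (0 < l <= n)%N -> (k %| l)%N -> hi g l = n.
Proof.
have [g0 gn pos inj] := prof_g.
move=> per l lr /dvdnP[q def_l]; rewrite mulnC in def_l.
have perq p j : (k * p + j < n)%N -> step g (k * p + j) = step g j.
  by elim: p => [|p IHp] lt; rewrite ?muln0 // mulnS -addnA per ?IHp //; lia.
have addq j : (l + j <= n)%N -> g (l + j)%N = g l + g j.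
  elim: j => [|j IHj] le; first by rewrite addn0 g0 addr0.
  by have := perq q j; rewrite -def_l /step addnS IHj; try lia; move=> /(_ ltac:(lia)); lia.
apply: hiE => //; [lia|by rewrite gn pos|move=> j jr].
have -> : j = (l + (j - l))%N by lia.
by rewrite addq; [have := pos (j - l)%N; lia|lia].
Qed.

Hypothesis hi_n : forall l, (0 < l <= n)%N -> (k %| l)%N -> hi g l = n.

Lemma symmetric_min l j : (0 < l <= n)%N -> (k %| l)%N -> (l < j <= n)%N -> g l < g j.
Proof.
by move=> lr dvd jr; have [_ _] := hi_spec prof_g lr; rewrite hi_n // => H; apply: H; lia.
Qed.

Lemma multiple_between i : (0 < i)%N -> exists2 l, (k %| l)%N & (i <= l < i + k)%N.
Proof.
move=> i0; exists (k * (i.-1 %/ k).+1)%N; first exact: dvdn_mulr.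
have := divn_eq i.-1 k; have := @ltn_pmod i.-1 k; nia.
Qed.

Lemma divisor_le_sub : (k <= n - k)%N.
Proof. by apply: dvdn_leq; [lia|rewrite dvdn_sub]. Qed.

(** The heights after a multiple l of k exceed g(l), so a backward search starting beyond l returns
    at least l. A multiple between i and i + k thus keeps the two positions apart; when i + k passes
    n, the multiple n - k does. *)
Lemma symmetric_lo i : (0 < i <= n)%N -> lo g i <> lo g (shift k i).
Proof.
move=> ir; have n0 : (0 < n)%N by lia.
have [m1 m2 m3] := lo_spec prof_g ir.
have [l1 l2 l3] := lo_spec prof_g (shift_range k i n0).
move: l1 l2 l3; rewrite shiftE //; last by lia.
case: ifP => [le|gt] l1 l2 l3 eq_lo.
  have [l dvd lr] : exists2 l, (k %| l)%N & (i <= l < i + k)%N by apply: multiple_between; lia.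
  have := @symmetric_min l (i + k) ltac:(lia) dvd ltac:(lia).
  by have := l3 l; lia.
have le_nki : (n - k < i)%N by lia.
have := @symmetric_min (n - k) i ltac:(lia) (dvdn_sub k_dvd (dvdnn k)) ltac:(lia).
have le_k := divisor_le_sub.
by have := m3 (n - k)%N; lia.
Qed.

(** A forward search that passes a multiple l of k can stop only at n, since the heights after l
    exceed g(l). Of two translates with a common end, one passes such an l. *)
Lemma symmetric_hi i : (0 < i <= n)%N -> hi g i = hi g (shift k i) -> hi g i = n.
Proof.
move=> ir; have n0 : (0 < n)%N by lia.
have [/andP[m1 m1'] m2 m3] := hi_spec prof_g ir.
have [/andP[l1 l1'] l2 l3] := hi_spec prof_g (shift_range k i n0).
have le_k := divisor_le_sub.
move: l1 l1' l2 l3; rewrite shiftE //; last by lia.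
case: ifP => [le|gt] l1 l1' l2 l3 eq_hi; case: (ltngtP (hi g i) n) m1' => // lt _.
  have [l dvd lr] : exists2 l, (k %| l)%N & (i <= l < i + k)%N by apply: multiple_between; lia.
  have := @symmetric_min l (hi g i).+1 ltac:(lia) dvd ltac:(lia).
  have : g i <= g l.
    by case: (ltngtP i l) => [lt'|lt'|-> //]; [apply/ltW/m3; lia|lia].
  by lia.
have := @symmetric_min k (hi g i).+1 ltac:(lia) (dvdnn k) ltac:(lia).
have : g (i + k - n)%N <= g k.
  by case: (ltngtP (i + k - n) k) => [lt'|lt'|-> //]; [apply/ltW/l3; lia|lia].
by rewrite eq_hi; lia.
Qed.
End Symmetric.

Lemma shiftD t u i : shift t (shift u i) = shift (u + t) i.
Proof. by rewrite /shift /= modnDml addnA. Qed.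

Lemma shift_mod t i : shift (t %% n) i = shift t i.
Proof. by rewrite /shift modnDmr. Qed.

Lemma shift_multiple q i : (0 < i <= n)%N -> shift (q * n) i = i.
Proof. by move=> ir; rewrite /shift addnC modnMDl modn_small; lia. Qed.

(* The edges of the tree of a profile are the labels i, joining the vertices
   [block true g i] (its block of P) and [block false g i] (its block of Q). *)
Definition block (o : bool) g (i : nat) : nat := if o then lo g i else hi g i.

Definition vroot (o : bool) : nat := if o then 0%N else n.

(** Numbers the labels by residues modulo n so that number 0 lies at [vroot o]: label 1 at the
    P-vertex 0, label n at the Q-vertex n. Rotation becomes addition, see [shift_edge]. *)
Definition edge (o : bool) (k : nat) : nat :=
  if o then k.+1 else if k == 0%N then n else k.

Lemma edge_range o k : (k < n)%N -> (0 < edge o k <= n)%N.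
Proof. by case: o => //= lt; case: eqP; lia. Qed.

Lemma edge_exists o i : (0 < i <= n)%N -> exists2 k, (k < n)%N & i = edge o k.
Proof.
move=> ir; case: o; first by exists i.-1; rewrite /=; lia.
case: (i =P n) => [->|ne]; [by exists 0%N => //; lia|by exists i; rewrite /= ?ifF //; lia].
Qed.

Lemma shift_edge o t k : (k < n)%N -> shift t (edge o k) = edge o ((k + t) %% n)%N.
Proof.
move=> lt; rewrite -shift_mod -modnDmr.
have : (t %% n < n)%N by rewrite ltn_mod (leq_ltn_trans _ lt).
move: (t %% n)%N => u ltu; rewrite shiftE ?edge_range //; last by lia.
have -> : ((k + u) %% n = if (k + u < n)%N then k + u else k + u - n)%N.
  case: ltnP => le; first by rewrite modn_small.
  have {1}-> : (k + u = k + u - n + n)%N by lia.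
  by rewrite modnDr modn_small; lia.
case: o => /=; first by repeat case: ifP; lia.
by case: (k =P 0%N) => [->|k0]; repeat case: ifP; lia.
Qed.

Lemma block_shift o t g h i j : shift_similar t g h ->
    (0 < i <= n)%N -> (0 < j <= n)%N ->
  (block o h (shift t i) == block o h (shift t j)) = (block o g i == block o g j).
Proof. by move=> sim ir jr; have [_ _ s3 s4] := sim i ir; case: o; [exact: s3|exact: s4]. Qed.

Lemma lo_le g i : profile g -> (0 < i <= n)%N -> (lo g i <= n)%N.
Proof. by move=> pg ir; have [] := lo_spec pg ir; lia. Qed.

Lemma hi_le g i : profile g -> (0 < i <= n)%N -> (hi g i <= n)%N.
Proof. by move=> pg ir; have [/andP[]] := hi_spec pg ir. Qed.

Hypothesis n_gt0 : (0 < n)%N.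

Lemma block_edge0 o g : profile g -> block o g (edge o 0) = vroot o.
Proof.
have nr : (0 < n <= n)%N by rewrite n_gt0 leqnn.
move=> pg; case: o => /=.
  by have [//|lt _ _] := @lo_spec g 1 pg; lia.
by have [/andP[le1 le2] _ _] := hi_spec pg nr; lia.
Qed.

Section SymmetricBlock.
Variables (g : nat -> int) (k : nat) (o : bool).
Hypothesis prof_g : profile g.
Hypothesis k_range : (0 < k < n)%N.
Hypothesis k_dvd : (k %| n)%N.

(** The boolean [o] is read as an offset: the n steps turning about vertex 0 are 1, ..., n, those
    about vertex n are 0, ..., n - 1. *)
Lemma periodic_block :
    (forall j, (k + j < n)%N -> step g (o + (k + j)) = step g (o + j)) ->
  forall l, (l < n)%N -> (k %| l)%N -> block o g (edge o l) = vroot o.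
Proof.
move=> per [_ _|l lt dvd]; first exact: block_edge0.
case: o per => /= per; last by apply: (@periodic_hi g k) => //; lia.
(* For P this is [periodic_hi] applied to the reversed profile. *)
have prof_r := profile_rev prof_g.
have dvd' : (k %| n - l.+1)%N by rewrite dvdn_sub.
have le := @lo_le g l.+2 prof_g ltac:(lia).
suff : hi (rev_profile g) (n - l.+1) = n.
  rewrite hi_rev //; last by lia.
  by rewrite (_ : n.+1 - (n - l.+1) = l.+2)%N /=; lia.
apply: (@periodic_hi _ k) => //; last by lia.
move=> j jr; rewrite !step_rev; try lia.
congr (- _); have := per (n - (k + j).+1)%N ltac:(lia).
rewrite (_ : 1 + (k + (n - (k + j).+1)) = n - j)%N; last by lia.
by rewrite (_ : 1 + (n - (k + j).+1) = n - (k + j))%N; last by lia.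
Qed.

Hypothesis central : forall l, (l < n)%N -> (k %| l)%N -> block o g (edge o l) = vroot o.

Lemma symmetric_block i : (0 < i <= n)%N ->
  (block o g i = block o g (shift k i) -> block o g i = vroot o) /\
  block (~~ o) g i <> block (~~ o) g (shift k i).
Proof.
move=> ir; have sr := shift_range k i n_gt0.
case: o central => /= cen; last first.
  have hi_n l : (0 < l <= n)%N -> (k %| l)%N -> hi g l = n.
    move=> lr dvd; case: (ltngtP l n) lr => [lt lr|lt|-> _] //; try lia.
      by have := cen l lt dvd; rewrite ifF //; lia.
    exact: (block_edge0 false prof_g).
  by split; [exact: (symmetric_hi prof_g)|exact: (symmetric_lo prof_g)].
have prof_r := profile_rev prof_g.
have hi_n l : (0 < l <= n)%N -> (k %| l)%N -> hi (rev_profile g) l = n.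
  move=> lr dvd; rewrite hi_rev //.
  by have := cen (n - l)%N; rewrite subSn ?dvdn_sub //; [move=> ->; lia|lia].
have xr : (0 < n.+1 - shift k i <= n)%N by lia.
have shift_x : shift k (n.+1 - shift k i) = (n.+1 - i)%N.
  by rewrite !shiftE; try lia; repeat case: ifP; lia.
have subK j : (0 < j <= n)%N -> (n.+1 - (n.+1 - j) = j)%N by lia.
split=> [eq_lo|eq_hi].
  have := @symmetric_hi _ _ prof_r k_range k_dvd hi_n _ xr.
  rewrite shift_x !hi_rev //; last by lia.
  by rewrite !subK // eq_lo => /(_ erefl); have := lo_le prof_g sr; lia.
have := @symmetric_lo _ _ prof_r k_range k_dvd hi_n _ xr.
by rewrite shift_x !lo_rev //; [rewrite !subK // eq_hi|lia].
Qed.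
End SymmetricBlock.

Lemma step_neq0 g c : profile g -> (c <= n)%N -> step g c <> 0.
Proof.
move=> [g0 gn pos inj]; rewrite /step leq_eqVlt => /orP[/eqP ->|lt].
  by rewrite gn; have := pos n; lia.
by have := inj c.+1 c; lia.
Qed.

(** An up step at c makes c + 1 a label of the P-block at c; a down step makes c a label of the
    Q-block at c. So the n + 1 positions are the vertices, each of one type. *)
Lemma vertex_block g c : profile g -> (c <= n)%N ->
  exists2 i, (0 < i <= n)%N & c = block (0 < step g c) g i.
Proof.
move=> pg lec; have [g0 gn pos inj] := pg; have := step_neq0 pg lec.
case: (ltrgtP 0 (step g c)) => [up _|down _|<- //] /=.
  have ltcn : (c < n)%N.
    rewrite ltn_neqAle lec andbT; apply/eqP => eq_c; move: up.
    by rewrite /step eq_c gn; have := pos n; lia.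
  by exists c.+1; rewrite // lo_step_pos.
have c0 : (0 < c)%N.
  by case: c down {lec} => //; rewrite /step g0; have := pos 1%N; lia.
by exists c; rewrite ?c0 // hi_step_neg ?c0.
Qed.

(* Counting vertices modulo a prime: the rotation acts on the n + 1 vertices,
   and n + 1 is 1 modulo the order q of the rotation. *)
Lemma invariant_block g q : profile g -> prime q -> (q %| n)%N ->
    shift_similar (n %/ q) g g ->
  exists o i, (0 < i <= n)%N /\ block o g i = block o g (shift (n %/ q) i).
Proof.
move=> pg q_pr q_dvd; set d := (n %/ q)%N => sim.
have block_sign o i : (0 < i <= n)%N -> (0 < step g (block o g i)) = o.
  by case: o => ir /=; [case: (step_lo pg ir)|case: (step_hi pg ir)]; lia.
have block_le o i : (0 < i <= n)%N -> (block o g i <= n)%N.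
  by case: o => ir /=; [apply: lo_le|apply: hi_le].
have rep (c : 'I_n.+1) : exists i, (0 < i <= n)%N && (c == block (0 < step g c) g i :> nat).
  have [|i ir ci] := @vertex_block g c pg; first by rewrite -ltnS.
  by exists i; rewrite ir; apply/eqP.
(* [tau] moves a vertex along with a chosen edge at it; by [block_shift] the choice does not matter,
   as [tauE] records. *)
pose tau (c : 'I_n.+1) : 'I_n.+1 := inord (block (0 < step g c) g (shift d (xchoose (rep c)))).
have tauE o i (c : 'I_n.+1) : (0 < i <= n)%N -> val c = block o g i ->
    val (tau c) = block o g (shift d i).
  move=> ir def_c; have /andP[jr /eqP def_c'] := xchooseP (rep c).
  have sign_c : (0 < step g c) = o by rewrite def_c block_sign.
  rewrite /tau /=; move: (xchoose _) jr def_c' => j jr def_c'.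
  rewrite sign_c in def_c'; rewrite sign_c inordK ?ltnS ?block_le ?shift_range //.
  by apply/eqP; rewrite (block_shift o sim) // -def_c' def_c.
have iter_tau t (c : 'I_n.+1) o i : (0 < i <= n)%N -> val c = block o g i ->
    val (iter t tau c) = block o g (shift (t * d) i).
  move=> ir def_c; elim: t => [|t IHt] /=.
    by rewrite mul0n -(mul0n n) shift_multiple.
  by rewrite (tauE o (shift (t * d) i)) ?shift_range // shiftD mulSn addnC.
have tau_q c : iter q tau c = c.
  have [|i ir def_c] := @vertex_block g c pg; first by rewrite -ltnS.
  apply: val_inj; rewrite (iter_tau q c _ i ir def_c) mulnC divnK //.
  by have := @shift_multiple 1 i ir; rewrite mul1n => ->.
have tau_inj : injective tau.
  have q0 := prime_gt0 q_pr.
  apply: (can_inj (g := iter q.-1 tau)) => c.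
  by rewrite -iterSr prednK.
pose s := perm tau_inj.
have sX t c : (s ^+ t)%g c = iter t tau c.
  by rewrite permX; elim: t => //= t ->; rewrite permE.
have [||c] := @prime_order_fixpoint _ s q q_pr.
- by apply/permP => c; rewrite sX tau_q perm1.
- by rewrite card_ord -addn1 dvdn_addr // Euclid_dvd1.
rewrite permE => tau_c.
have [|i ir def_c] := @vertex_block g c pg; first by rewrite -ltnS.
by exists (0 < step g c), i; split=> //; rewrite -(tauE _ _ c ir def_c) tau_c -def_c.
Qed.
End Profiles.

Local Close Scope ring_scope.
Local Open Scope nat_scope.

(** * The labeled pair of a Dyck path *)

Section LevelPartitions.
Variables (n : nat) (T : finType).

Definition level_part (f : 'I_n -> nat) (r : nat -> T) : {set {set 'I_n} * T} :=
  [set ([set j | f i == f j], r (f i)) | i in [set: 'I_n]].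

Lemma map_level_part (s : 'I_n -> 'I_n) (f f' : 'I_n -> nat) (r r' : nat -> T) :
    injective s ->
  [set (s @: x.1, x.2) | x : {set 'I_n} * T in level_part f r] = level_part f' r' <->
  forall i, r' (f' (s i)) = r (f i) /\ forall j, (f' (s i) == f' (s j)) = (f i == f j).
Proof.
move=> s_inj; rewrite /level_part -imset_comp; split=> [eq_parts i|sim].
  have : (s @: [set j | f i == f j], r (f i)) \in level_part f' r'.
    by rewrite /level_part -eq_parts; apply/imsetP; exists i; rewrite ?inE.
  case/imsetP=> k _ [eq_block eq_rank].
  have eq_k : f' k = f' (s i).
    have : s i \in s @: [set j | f i == f j] by apply: imset_f; rewrite inE.
    by rewrite eq_block inE => /eqP.
  rewrite -eq_k eq_rank; split=> // j.
  have := mem_imset [set j | f i == f j] j s_inj.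
  by rewrite eq_block !inE.
have [s' sK s'K] := injF_bij s_inj.
apply/setP => x; apply/imsetP/imsetP => -[i _ ->].
  exists (s i); rewrite ?inE //=; have [-> eq_f] := sim i; congr (_, _).
  by apply/setP => j; rewrite -[j]s'K mem_imset // !inE eq_f.
exists (s' i); rewrite ?inE //=; have [] := sim (s' i).
rewrite s'K => -> eq_f; congr (_, _).
by apply/setP => j; rewrite -[j]s'K mem_imset // !inE -eq_f s'K.
Qed.
End LevelPartitions.

Section Paths.
Variables a n : nat.
Implicit Types D E : n.+1.-tuple 'I_a.+1.

Definition profile_of D (i : nat) : int :=
  ((n.+1 * height D i)%N%:Z - (a * i)%N%:Z)%R.

Lemma heightS D i : height D i.+1 = height D i + run D i.
Proof. by rewrite /height big_ord_recr. Qed.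

Lemma step_profile D c : step (profile_of D) c = ((n.+1 * run D c)%N%:Z - a%:Z)%R.
Proof. by rewrite /step /profile_of heightS mulnDr mulnS; lia. Qed.

Lemma step_profile_inj D E c d :
  step (profile_of D) c = step (profile_of E) d -> run D c = run E d.
Proof.
rewrite !step_profile => eq_step; apply/val_inj/eqP => /=.
by rewrite -(eqn_pmul2l (ltn0Sn n)); lia.
Qed.

Lemma dyck_profile D : profile_of D n.+1 = 0%R ->
  (forall i, i <= n -> (0 <= profile_of D i)%R) -> D \in dyck a n.+1.
Proof.
move=> end0 nonneg; rewrite inE; apply/andP; split.
  by move: end0; rewrite /profile_of => end0; apply/eqP; nia.
apply/forallP => i; have := ltn_ord i; rewrite ltnS leq_eqVlt => /orP[/eqP ->|lt].
  by move: end0; rewrite /profile_of; lia.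
by have := nonneg i lt; rewrite /profile_of; lia.
Qed.

Hypothesis cop : coprime a n.+1.
Hypothesis a_gt0 : 0 < a.

(** Modulo n + 1 the value g(i) is -a i, and a is invertible. *)
Lemma profile_of_inj D i j : i <= n -> j <= n -> profile_of D i = profile_of D j -> i = j.
Proof.
wlog lt : i j / i < j => [hw lei lej eq_ij|lei lej].
  by case: (ltngtP i j) => // lt; [exact: hw|apply/esym/hw].
rewrite /profile_of => eq_ij.
have le_h : height D i <= height D j.
  elim: j lt {lej eq_ij} => // j IHj; rewrite ltnS leq_eqVlt => /orP[/eqP ->|/IHj le].
    by rewrite heightS leq_addr.
  by rewrite heightS (leq_trans le) // leq_addr.
have dvd : n.+1 %| a * (j - i).
  by apply/dvdnP; exists (height D j - height D i); nia.
move: dvd; rewrite Gauss_dvdr; last by rewrite coprime_sym.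
by move/dvdn_leq; lia.
Qed.

Lemma profile_of_dyck D : D \in dyck a n.+1 -> profile n (profile_of D).
Proof.
rewrite inE => /andP[/eqP hb /forallP above].
have nonneg i : i <= n.+1 -> (0 <= profile_of D i)%R.
  by move=> le; have := above (inord i); rewrite inordK // /profile_of; lia.
have g0 : profile_of D 0 = 0%R by rewrite /profile_of /height big_ord0; lia.
split=> //; first by rewrite /profile_of hb; lia.
  move=> i ir; rewrite lt_neqAle nonneg; last by lia.
  by rewrite andbT; apply/eqP; rewrite -g0 => /(@profile_of_inj D); lia.
exact: profile_of_inj.
Qed.

Section Dyck.
Variable D : n.+1.-tuple 'I_a.+1.
Hypothesis dyckD : D \in dyck a n.+1.
Let g := profile_of D.
Let pg : profile n g := profile_of_dyck dyckD.

Lemma crosses_profile i j :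
  crosses D i j = ((g i < g j.+1 + a%:Z) && (g j.+1 < g i))%R.
Proof. by rewrite /crosses /g /profile_of; congr (_ && _); lia. Qed.

(** The first descent below g(i) satisfies the other inequality of [crosses] too, since a step goes
    down by at most a; when it occurs at i itself, strictness comes from the nonempty run. *)
Lemma laserE i j : 0 < i <= n ->
  laser D i j = (0 < run D i) && (hi n g i == j).
Proof.
move=> ir; have [/andP[m1 m1'] m2 m3] := hi_spec pg ir.
rewrite /laser; case/andP: (ir) => -> _ /=; case: (posnP (run D i)) => [_|run0] //=.
have crosses_hi : crosses D i (hi n g i).
  rewrite crosses_profile m2 andbT.
  have := step_profile D (hi n g i); rewrite /step -/g => E.
  case: (ltngtP i (hi n g i)) m1 => // [lt|eq_i] _; first by have := m3 (hi n g i); lia.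
  by move: E; rewrite -eq_i; nia.
apply/idP/eqP => [/and4P[leij ltj cr /forallP first]|<-].
  have le_hi : hi n g i <= j.
    rewrite leqNgt; apply/negP => lt; move: cr; rewrite crosses_profile => /andP[_].
    by have := m3 j.+1; lia.
  case: (ltngtP (hi n g i) j) le_hi => // lt _.
  by have := first (Ordinal lt); rewrite /= m1 crosses_hi.
rewrite m1 ltnS m1' crosses_hi /=; apply/forallP => k; apply/implyP => leik.
by rewrite crosses_profile; have := m3 k.+1; have := ltn_ord k; lia.
Qed.

Lemma aboveP k i : k <= n -> 0 < i <= n ->
  reflect (0 < k /\ k < i /\ forall j, k < j <= i -> (g k < g j)%R) (above D k i).
Proof.
move=> lekn ir; apply: (iffP existsP) => [[m /and3P[las /andP[leki leim] lt]]|[k0 [ltki up]]].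
  have k0 : 0 < k by case/andP: las.
  move: las; rewrite laserE ?k0 ?lekn // => /andP[_ /eqP hi_m].
  have kr : 0 < k <= n by rewrite k0.
  have [_ m2 m3] := hi_spec pg kr.
  have lt' : (g k < g i)%R by rewrite /g /profile_of; lia.
  have ltki : k < i by case: (ltngtP k i) leki lt' => // ->; rewrite ltxx.
  by split=> //; split=> // j jr; apply: m3; lia.
have kr : 0 < k <= n by rewrite k0.
have [/andP[m1 m1'] m2 m3] := hi_spec pg kr.
exists (inord (hi n g k)); rewrite inordK // laserE // eqxx andbT.
have lei : i <= hi n g k.
  by rewrite leqNgt; apply/negP => lt; have := up (hi n g k).+1; lia.
have := up i; have := up k.+1; have := step_profile D k.
rewrite /step -/g => E H1 H2.
rewrite (ltnW ltki) lei /=; apply/andP; split; first by have := H1 ltac:(lia); nia.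
by have := H2 ltac:(lia); rewrite /g /profile_of; lia.
Qed.

(** Being above the laser of k depends on i only through [lo g i], because the heights between that
    position and i exceed g(i). This yields one direction of [PrelE]. *)
Lemma above_lo k i : k <= n -> 0 < i <= n ->
  above D k i <-> [/\ 0 < k, k <= lo g i & forall j, k < j <= lo g i -> (g k < g j)%R].
Proof.
move=> lekn ir; have [m1 m2 m3] := lo_spec pg ir.
split=> [/(aboveP lekn ir)[k0 [ltki up]]|[k0 le up]].
  have le : k <= lo g i.
    by rewrite leqNgt; apply/negP => lt; have := up i; have := m3 k; lia.
  by split=> // j jr; apply: up; lia.
apply/(aboveP lekn ir); split=> //; split; first by lia.
have le_lo : (g k <= g (lo g i))%R.
  by case: (ltngtP k (lo g i)) le => // [lt _|-> //]; apply/ltW/up; lia.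
move=> j jr; case: (leqP j (lo g i)) => [le_j|lt_j]; first by apply: up; lia.
by case: (ltngtP j i) jr => [lt _|lt|-> _]; [have := m3 j; lia|lia|lia].
Qed.

Lemma PrelE i j : Prel D i j = (lo g (label i) == lo g (label j)).
Proof.
have lab (k : 'I_n.+1.-1) : 0 < label k <= n by rewrite /label /=; exact: ltn_ord.
(* The laser issued from the larger of the two positions has y above it but not x. *)
have asym x y : 0 < x <= n -> 0 < y <= n -> lo g x < lo g y ->
    above D (lo g y) x != above D (lo g y) y.
  move=> xr yr lt; have [m1 m2 m3] := lo_spec pg yr.
  have -> : above D (lo g y) y by apply/(above_lo _ yr); [lia|split; lia].
  by apply/negP => /eqP/(above_lo _ xr)[]; lia.
apply/forallP/eqP => [sep|eq_lo k]; last first.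
  rewrite /separates negbK; apply/eqP.
  have lek : k <= n by rewrite -ltnS.
  by apply/idP/idP => /(above_lo lek (lab _)) H; apply/(above_lo lek (lab _));
    rewrite ?eq_lo // -eq_lo.
case: (ltngtP (lo g (label i)) (lo g (label j))) => // lt.
  have [m1 _ _] := lo_spec pg (lab j); have lr := lab j.
  have := sep (inord (lo g (label j))); rewrite /separates inordK; last by lia.
  by rewrite (asym _ _ (lab i) (lab j) lt).
have [m1 _ _] := lo_spec pg (lab i); have lr := lab i.
have := sep (inord (lo g (label i))); rewrite /separates inordK; last by lia.
by rewrite eq_sym (asym _ _ (lab j) (lab i) lt).
Qed.

Lemma QrelE i j : Qrel D i j = (hi n g (label i) == hi n g (label j)).
Proof.
have lab (k : 'I_n.+1.-1) : 0 < label k <= n by rewrite /label /=; exact: ltn_ord.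
apply/idP/eqP => [|eq_hi].
  have gen x y : Qgen D x y -> hi n g (label x) = hi n g (label y).
    case/or3P => [/existsP[m /and3P[_]]| |]; rewrite !laserE ?lab //.
    - by move=> /andP[_ /eqP ->] /andP[_ /eqP].
    - by case/andP=> _ /eqP <-; rewrite (step_hi pg (lab x)).1.
    - by case/andP=> _ /eqP <-; rewrite (step_hi pg (lab y)).1.
  by case/connectP => p; elim: p i => [|k p IHp] i /= => [_ -> //|/andP[/gen -> /IHp]].
have sym : connect_sym (Qgen D).
  apply: sym_connect_sym => x y; rewrite /Qgen; congr (_ || _); last by rewrite orbC.
  by apply: eq_existsb => m; rewrite [laser _ (label x) _ && _]andbC.
(* Each label is joined to the greatest label of its block by its own laser; a label without laser
   is that greatest label. *)
have to_max (x y : 'I_n.+1.-1) : label y = hi n g (label x) -> Qrel D x y.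
  move=> def_y; have [run0|run0] := posnP (run D (label x)); last first.
    by apply: connect1; rewrite /Qgen laserE ?lab // run0 def_y eqxx orbT.
  suff -> : x = y by apply: connect0.
  apply/val_inj/succn_inj; rewrite -/(label x) -/(label y) def_y.
  apply/esym/(hi_step_neg pg (lab x)); rewrite step_profile run0; lia.
have [/andP[m1 m1'] _ _] := hi_spec pg (lab i).
have lt_max : (hi n g (label i)).-1 < n.+1.-1 by have lr := lab i; lia.
have def_max : label (Ordinal lt_max) = hi n g (label i) 
  by have lr := lab i; change ((hi n g (label i)).-1.+1 = hi n g (label i)); lia.
apply: (@connect_trans _ _ (Ordinal lt_max)); first exact: to_max.
by rewrite sym; apply: to_max; rewrite -eq_hi.
Qed.

Lemma bigmin_attained (T : finType) (B : {set T}) (F : T -> nat) m x :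
  x \in B -> F x <= m -> (forall y, y \in B -> F x <= F y) ->
  \big[minn/m]_(y in B) F y = F x.
Proof.
move=> xB xm min_x; apply/eqP; rewrite eqn_leq; apply/andP; split; last first.
  by elim/big_ind: _ => [//|y z le1 le2|y yB]; rewrite ?leq_min ?le1 // min_x.
have: x \in index_enum T by rewrite mem_index_enum.
elim: (index_enum T) => // y s IHs; rewrite inE big_cons => /orP[/eqP <-|/IHs le].
  by rewrite xB geq_minl.
by case: ifP => // _; rewrite geq_min le orbT.
Qed.

Lemma PpartE : Ppart D = level_part (fun i : 'I_n => lo g i.+1) (run D).
Proof.
rewrite /Ppart /equivalence_partition -imset_comp /level_part.
apply: eq_imset => i /=.
have -> : [set y in setT | Prel D i y] = [set j : 'I_n | lo g i.+1 == lo g j.+1].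
  by apply/setP => j; rewrite !inE PrelE.
congr (_, run D _).
have ir : 0 < i.+1 <= n by rewrite ltn_ord.
have [m1 m2 m3] := lo_spec pg ir.
have lt_lo : lo g i.+1 < n by lia.
rewrite /minlabel (@bigmin_attained _ _ _ _ (Ordinal lt_lo)) //=.
- by rewrite inE /= (step_lo pg ir).1.
- by apply: leqW; exact: lt_lo.
move=> j; rewrite inE => /eqP eq_lo; have jr : 0 < j.+1 <= n by rewrite ltn_ord.
by have [lt_j _ _] := lo_spec pg jr; change ((lo g i.+1).+1 <= j.+1); rewrite eq_lo.
Qed.

Lemma QpartE : Qpart D = level_part (fun i : 'I_n => hi n g i.+1) (run D).
Proof.
rewrite /Qpart /equivalence_partition -imset_comp /level_part.
apply: eq_imset => i /=.
have -> : [set y in setT | Qrel D i y] = [set j : 'I_n | hi n g i.+1 == hi n g j.+1].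
  by apply/setP => j; rewrite !inE QrelE.
congr (_, run D _).
have ir : 0 < i.+1 <= n by rewrite ltn_ord.
have [/andP[m1 m1'] m2 m3] := hi_spec pg ir.
have lt_hi : (hi n g i.+1).-1 < n by lia.
have hiK : (hi n g i.+1).-1.+1 = hi n g i.+1 by lia.
rewrite /maxlabel; apply/eqP; rewrite eqn_leq; apply/andP; split.
  apply/bigmax_leqP => j; rewrite inE => /eqP ->.
  have jr : 0 < j.+1 <= n by rewrite ltn_ord.
  by have [/andP[]] := hi_spec pg jr.
rewrite -[X in X <= _]hiK.
apply: (@leq_bigmax_cond _ (mem [set j : 'I_n | hi n g i.+1 == hi n g j.+1])
          (@label n.+1) (Ordinal lt_hi)).
by rewrite !inE /= hiK (step_hi pg ir).1.
Qed.

End Dyck.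

Definition part_pair D := (Ppart D, Qpart D).

Lemma iter_rotE t (x : {set {set 'I_n} * 'I_a.+1} * {set {set 'I_n} * 'I_a.+1}) :
  let rotl (L : {set {set 'I_n} * 'I_a.+1}) :=
    [set (iter t (@ordS n) @: y.1, y.2) | y : {set 'I_n} * 'I_a.+1 in L] in
  iter t (@Defs.rot a n.+1) x = (rotl x.1, rotl x.2).
Proof.
case: x => P Q /=; elim: t => [|t IHt] /=.
  congr (_, _); rewrite -[LHS]imset_id; apply: eq_imset => -[B r] /=;
  by rewrite imset_id.
rewrite IHt /Defs.rot /rot_ranked -!imset_comp; congr (_, _); apply: eq_imset => -[B r] /=;
by rewrite /rot_block /= -imset_comp.
Qed.

Lemma shift_similarP t D E : D \in dyck a n.+1 -> E \in dyck a n.+1 ->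
  iter t (@Defs.rot a n.+1) (part_pair D) = part_pair E <->
  shift_similar n t (profile_of D) (profile_of E).
Proof.
move=> dyckD dyckE; rewrite iter_rotE /part_pair /= !PpartE // !QpartE //.
have s_inj : injective (iter t (@ordS n)).
  elim: t => [|t IHt] x y //= /(can_inj (@ordSK n)); exact: IHt.
have label_s (i : 'I_n) : (iter t (@ordS n) i).+1 = shift n t i.+1.
  by rewrite /shift /=; have /= -> := @iter_ordS n.+1 t i.
split=> [[/(map_level_part _ _ _ _ s_inj) simP /(map_level_part _ _ _ _ s_inj) simQ]|sim].
  move=> [//|i] /= lt; have [rP eqP] := simP (Ordinal lt); have [rQ eqQ] := simQ (Ordinal lt).
  move: rP eqP rQ eqQ; rewrite !label_s !step_profile /= => -> eqP -> eqQ; split=> //.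
    by move=> [//|j] /= ltj; have := eqP (Ordinal ltj); rewrite label_s.
  by move=> [//|j] /= ltj; have := eqQ (Ordinal ltj); rewrite label_s.
congr (_, _); apply/(map_level_part _ _ _ _ s_inj) => i;
  have [s1 s2 s3 s4] := sim i.+1 (ltn_ord i); rewrite !label_s.
  by split=> [|j]; [apply: step_profile_inj|rewrite label_s s3 //=].
by split=> [|j]; [apply: step_profile_inj|rewrite label_s s4 //=].
Qed.

End Paths.

(** * Rotation *)

Section Rotation.
Variables a n : nat.
Implicit Types D E F : n.+1.-tuple 'I_a.+1.
Local Notation rotp := (@Defs.rot a n.+1).
Local Notation dyckp := (dyck a n.+1).

Definition path_of (w : nat -> 'I_a.+1) : n.+1.-tuple 'I_a.+1 := [tuple w i | i < n.+1].

Lemma run_path_of w i : i <= n -> run (path_of w) i = w i.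
Proof.
move=> le; exact: (nth_mktuple (fun i : 'I_n.+1 => w i) ord0 (Ordinal (le : i < n.+1))).
Qed.

Lemma profile_of0 D : profile_of D 0 = 0%R.
Proof. by rewrite /profile_of /height big_ord0; lia. Qed.

Lemma eq_run D E : (forall i, i <= n -> run D i = run E i) -> D = E.
Proof.
move=> eq_DE; apply: eq_from_tnth => i.
by rewrite !(tnth_nth ord0); apply: eq_DE; rewrite -ltnS.
Qed.

Hypothesis cop : coprime a n.+1.
Hypothesis a_gt0 : 0 < a.
Hypothesis n_gt0 : 0 < n.
Let prof D := @profile_of_dyck a n cop a_gt0 D.
Let simP := @shift_similarP a n cop a_gt0.

Lemma rot_dyck D : D \in dyckp ->
  exists2 E, E \in dyckp & rotp (part_pair D) = part_pair E.
Proof.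
move=> dyckD; set g := profile_of D; set p := lo g n.
pose w i := if i == 0 then run D p else if i == p.+1 then run D n else run D i.-1.
have nr : 0 < n <= n by rewrite n_gt0 leqnn.
have pg := prof dyckD; have [lt_pn _ _] := lo_spec pg nr.
have h0 := profile_of0 (path_of w).
have step0 : step (profile_of (path_of w)) 0 = step g p.
  by rewrite !step_profile run_path_of.
have stepS j : j < n -> j != p -> step (profile_of (path_of w)) j.+1 = step g j.
  by move=> lt /negbTE ne; rewrite !step_profile run_path_of // /w /= eqSS ne.
have step_p : step (profile_of (path_of w)) p.+1 = step g n.
  by rewrite !step_profile run_path_of // /w /= eqxx.
have dyckE : path_of w \in dyckp.
  apply: dyck_profile; first exact: (rotate_one_end n_gt0 pg h0 step0 stepS step_p).
  by move=> i le; apply: (rotate_one_ge0 n_gt0 pg h0 step0 stepS step_p); exact: leqW.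
exists (path_of w) => //.
apply/(@simP 1 D _ dyckD dyckE).
exact: (rotate_one_similar n_gt0 pg h0 step0 stepS step_p (prof dyckE)).
Qed.

Lemma iter_rot_dyck t D : D \in dyckp ->
  exists2 E, E \in dyckp & iter t rotp (part_pair D) = part_pair E.
Proof.
move=> dyckD; elim: t => [|t [E dyckE /= ->]]; [by exists D|exact: rot_dyck].
Qed.

Lemma iter_rot_n x : iter n rotp x = x.
Proof. by case: n n_gt0 x => // m _ x; exact: (@iter_rot_order a m.+2 x). Qed.

Lemma iter_rot_mod t x : iter (t %% n) rotp x = iter t rotp x.
Proof.
rewrite [in RHS](divn_eq t n) addnC iterD; congr (iter _ _ _).
by elim: (t %/ n) => // q IHq; rewrite mulSn iterD -IHq iter_rot_n.
Qed.

(* The runs of D other than the first one ([o = true]) or the last one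
   ([o = false]), read cyclically. *)
Definition word (o : bool) D (j : nat) : 'I_a.+1 := run D (o + j %% n).

Lemma word_mod o D j : word o D (j %% n) = word o D j.
Proof. by rewrite /word modn_mod. Qed.

Lemma word_run o D j : j < n -> word o D j = run D (o + j).
Proof. by move=> lt; rewrite /word modn_small. Qed.

Lemma height_dyck D : D \in dyckp -> height D n.+1 = a.
Proof. by rewrite inE => /andP[/eqP]. Qed.

Definition center_run (o : bool) D : 'I_a.+1 := run D (if o then 0 else n).

Lemma sum_word o D : D \in dyckp -> \sum_(j < n) word o D j + center_run o D = a.
Proof.
move=> dyckD; transitivity (height D n.+1); last exact: height_dyck.
rewrite /height /center_run; case: o.
  by rewrite [RHS]big_ord_recl addnC; congr (_ + _); apply: eq_bigr => i _; rewrite word_run.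
by rewrite [RHS]big_ord_recr; congr (_ + _); apply: eq_bigr => i _; rewrite word_run.
Qed.

(** The one run that the word omits is determined by the total height a. *)
Lemma word_inj o D E : D \in dyckp -> E \in dyckp ->
  (forall j, word o D j = word o E j) -> D = E.
Proof.
move=> dyckD dyckE eq_w.
have eq_c : center_run o D = center_run o E.
  apply/val_inj/(@addnI (\sum_(j < n) word o D j)).
  rewrite (sum_word o dyckD) -[LHS](sum_word o dyckE).
  by congr (_ + _); apply: eq_bigr => i _; rewrite eq_w.
apply: eq_run => i lei; case: o eq_w eq_c => eq_w eq_c.
  by case: i lei => [_|i lt]; [exact: eq_c|have := eq_w i; rewrite !word_run].
move: lei; rewrite leq_eqVlt => /orP[/eqP ->|lt]; first exact: eq_c.
by have := eq_w i; rewrite !word_run.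
Qed.

(** That the k-th edge lies at the root is a minimality property of g, and this keeps the path with
    the shifted word nonnegative. *)
Lemma rotate_word o D k : D \in dyckp -> k < n ->
    block n o (profile_of D) (edge n o k) = vroot n o ->
  exists2 F, F \in dyckp & forall j, word o F j = word o D (k + j).
Proof.
move=> dyckD; case: k => [_ _|k lt]; first by exists D.
have pg := prof dyckD; have [g0 gn pos _] := pg.
case: o => /= central; last first.
  pose w i := if i == n then run D n else run D ((k.+1 + i) %% n).
  pose F := path_of w.
  have stepL j : j < n - k.+1 -> step (profile_of F) j = step (profile_of D) (k.+1 + j).
    move=> ltj; rewrite !step_profile run_path_of /w; last by lia.
    by rewrite ifF ?modn_small //; lia.
  have stepR j : j < k.+1 -> step (profile_of F) (n - k.+1 + j) = step (profile_of D) j.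
    move=> ltj; rewrite !step_profile run_path_of /w; last by lia.
    rewrite ifF; last by lia.
    rewrite (_ : k.+1 + (n - k.+1 + j) = j + n); last by lia.
    by rewrite modnDr modn_small //; lia.
  have step_n : step (profile_of F) n = step (profile_of D) n.
    by rewrite !step_profile run_path_of // /w eqxx.
  have kr : 0 < k.+1 <= n by lia.
  have [end0 ge0] := rotate_last_ge0 kr pg (profile_of0 F) stepL stepR central step_n.
  exists F; first exact: dyck_profile.
  move=> j; rewrite -[LHS]word_mod /word modn_mod !add0n run_path_of /w; last first.
    by apply/ltnW; rewrite ltn_mod.
  by rewrite ltn_eqF ?ltn_mod // modnDmr.
(* For P the first run stays in front, and the piece of the path from label 1 to label k + 2 goes to
   the end. *)
pose w i := if i == 0 then run D 0 else run D ((k.+1 + i.-1) %% n).+1.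
pose F := path_of w; pose g := profile_of D; pose h := profile_of F.
have h00 : h 0 = 0%R by exact: profile_of0.
have g00 : g 0 = 0%R by exact: profile_of0.
have gn0 : g n.+1 = 0%R by exact: gn.
have h1 : h 1 = g 1.
  have : step h 0 = step g 0 by rewrite !step_profile run_path_of.
  by rewrite /step h00 g00; lia.
have hL j : j <= n - k.+1 -> h j.+1 = (g 1%N + g (k.+2 + j)%N - g k.+2)%R.
  elim: j => [|j IHj] lej; first by rewrite addn0 addrK.
  have : step h j.+1 = step g (k.+2 + j).
    by rewrite !step_profile run_path_of /w /= ?modn_small //; lia.
  by rewrite /step IHj ?(ltnW lej) // addnS; lia.
have hR j : j <= k.+1 -> h (n - k.+1 + j).+1 = (g j.+1 - g k.+2)%R.
  elim: j => [|j IHj] lej.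
    rewrite addn0 hL // (_ : k.+2 + (n - k.+1) = n.+1); last by lia.
    by rewrite gn0; lia.
  have : step h (n - k.+1 + j).+1 = step g j.+1.
    rewrite !step_profile run_path_of /w /=; last by lia.
    rewrite (_ : k.+1 + (n - k.+1 + j) = j + n); last by lia.
    by rewrite modnDr modn_small //; lia.
  by rewrite /step addnS IHj ?(ltnW lej) //; lia.
have kr : 0 < k.+2 <= n by lia.
(* [central] says [lo g k.+2 = 0]: all heights strictly between 0 and k + 2 exceed g(k + 2), which
   bounds both pieces of h from below. *)
have [_ _ min_k] := lo_spec pg kr; rewrite central in min_k.
have dyckF : F \in dyckp.
  apply: dyck_profile.
    by have := hR k.+1 (leqnn _); rewrite (subnK (ltnW lt)) /h => ->; lia.
  case=> [|j] lej; first by rewrite profile_of0.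
  case: (leqP j (n - k.+1)) => [le|gt].
    rewrite -/h hL //.
    have : (0 <= g (k.+2 + j)%N)%R.
      rewrite /g; case: (ltngtP (k.+2 + j) n.+1) => [lt'|lt'|->]; [|lia|by rewrite gn].
      by apply/ltW/pos; lia.
    by have := min_k 1; rewrite -/g; lia.
  have -> : j = n - k.+1 + (j - (n - k.+1)) by lia.
  rewrite -/h hR; last by lia.
  by have := min_k (j - (n - k.+1)).+1; rewrite -/g; lia.
exists F => // j; have ltj : j %% n < n by rewrite ltn_mod.
by rewrite /word !add1n run_path_of // /w /= modnDmr.
Qed.

Lemma word_rotate o D F k : D \in dyckp -> F \in dyckp -> k < n ->
    (forall j, word o F j = word o D (k + j)) ->
  iter (n - k) rotp (part_pair D) = part_pair F.
Proof.
move=> dyckD dyckF; case: k => [_ eq_w|k lt eq_w].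
  by rewrite subn0 iter_rot_n (word_inj dyckD dyckF (fun j => esym (eq_w j))).
apply/simP => //; case: o eq_w => eq_w; last first.
  have kr : 0 < k.+1 <= n by lia.
  apply: (rotate_last_similar kr (prof dyckD) (profile_of0 F)) (prof dyckF) => j ltj.
    rewrite !step_profile; have := eq_w j; rewrite !word_run ?add0n; try lia.
    by move=> ->.
  rewrite !step_profile; have := eq_w (n - k.+1 + j).
  rewrite (_ : k.+1 + (n - k.+1 + j) = j + n); last by lia.
  rewrite -[RHS]word_mod modnDr word_mod !word_run ?add0n; try lia.
  by move=> ->.
have kr : 0 < n - k.+1 <= n by lia.
(* In the reversed profiles the last vertex is central again, and the shift by k + 1 becomes one by
   n - (k + 1). *)
apply: shift_similar_rev; [exact: prof|exact: prof|lia|].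
rewrite -{1}(subKn (ltnW lt)).
have stepE E c : 0 < c <= n ->
    step (rev_profile n (profile_of E)) (n - c) = (- ((n.+1 * word true E c.-1)%N%:Z - a%:Z))%R.
  move=> cr; rewrite step_rev ?leq_subr // subKn ?step_profile; last by lia.
  by rewrite word_run ?add1n ?prednK //; lia.
apply: (rotate_last_similar kr (profile_rev (prof dyckD)) _ _ _ (profile_rev (prof dyckF))).
- by rewrite /rev_profile subn0; have [_ ->] := prof dyckF.
- move=> j ltj; rewrite (_ : j = n - (n - j)); last by lia.
  rewrite (_ : n - k.+1 + (n - (n - j)) = n - (k.+1 - j)); last by lia.
  rewrite !stepE; try lia; rewrite eq_w (_ : k.+1 + (n - j).-1 = (k.+1 - j).-1 + n); last by lia.
  by rewrite -word_mod modnDr word_mod.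
- move=> j ltj; rewrite (_ : n - (n - k.+1) + j = n - (n - k.+1 - j)); last by lia.
  rewrite {2}(_ : j = n - (n - j)); last by lia.
  by rewrite !stepE; try lia; rewrite eq_w (_ : k.+1 + (n - k.+1 - j).-1 = (n - j).-1); last by lia.
Qed.

(** [lo] plus 1 is the least label of a P-block and [hi] the greatest of a Q-block, so the
    partitions determine both functions; every run is then the rank at some vertex. *)
Lemma part_pair_inj D E : D \in dyckp -> E \in dyckp -> part_pair D = part_pair E -> D = E.
Proof.
move=> dyckD dyckE eq_pi; have [pD pE] := (prof dyckD, prof dyckE).
have {eq_pi} sim := (simP 0 dyckD dyckE).1 eq_pi.
have shift0 i : 0 < i <= n -> shift n 0 i = i.
  by move=> ir; have := shift_multiple 0 ir; rewrite mul0n.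
have lo_le_lo g h : profile n g -> profile n h ->
    (forall i j, 0 < i <= n -> 0 < j <= n -> (lo g i == lo g j) = (lo h i == lo h j)) ->
    forall i, 0 < i <= n -> lo g i <= lo h i.
  move=> pg ph eq_lo i ir; have [lt _ _] := lo_spec ph ir.
  have jr : 0 < (lo h i).+1 <= n by lia.
  have /eqP <- : lo g (lo h i).+1 == lo g i by rewrite eq_lo // (step_lo ph ir).1.
  by have [] := lo_spec pg jr.
have hi_le_hi g h : profile n g -> profile n h ->
    (forall i j, 0 < i <= n -> 0 < j <= n -> (hi n g i == hi n g j) = (hi n h i == hi n h j)) ->
    forall i, 0 < i <= n -> hi n h i <= hi n g i.
  move=> pg ph eq_hi i ir; have [/andP[le le'] _ _] := hi_spec ph ir.
  have jr : 0 < hi n h i <= n by lia.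
  have /eqP <- : hi n g (hi n h i) == hi n g i by rewrite eq_hi // (step_hi ph ir).1.
  by have [/andP[]] := hi_spec pg jr.
have eq_block o i : 0 < i <= n -> block n o (profile_of D) i = block n o (profile_of E) i.
  have eqb o' x y : 0 < x <= n -> 0 < y <= n ->
      (block n o' (profile_of E) x == block n o' (profile_of E) y) =
      (block n o' (profile_of D) x == block n o' (profile_of D) y).
    by move=> xr yr; have := block_shift o' sim xr yr; rewrite !shift0.
  move=> ir; apply/eqP; rewrite eqn_leq; case: o; apply/andP; split.
  - by apply: (lo_le_lo _ _ pD pE) => // x y xr yr; rewrite (eqb true).
  - by apply: (lo_le_lo _ _ pE pD) => // x y xr yr; rewrite (eqb true).
  - by apply: (hi_le_hi _ _ pE pD) => // x y xr yr; rewrite (eqb false).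
  - by apply: (hi_le_hi _ _ pD pE) => // x y xr yr; rewrite (eqb false).
apply: eq_run => c lec; have [i ir] := vertex_block n_gt0 pD lec.
move: (0 < _)%R => o ->; apply/esym/(@step_profile_inj a n).
have [s1 s2 _ _] := sim i ir; rewrite shift0 // in s1 s2.
by rewrite {1}eq_block //; case: o.
Qed.
End Rotation.

(** * Fixed points *)

Section Symmetry.
Variables a n k : nat.
Hypothesis cop : coprime a n.+1.
Hypothesis a_gt0 : 0 < a.
Hypothesis k_range : 0 < k < n.
Hypothesis k_dvd : k %| n.
Implicit Types D E F : n.+1.-tuple 'I_a.+1.
Local Notation rotp := (@Defs.rot a n.+1).
Local Notation dyckp := (dyck a n.+1).
Let n_gt0 : 0 < n. Proof. by lia. Qed.
Let prof D := @profile_of_dyck a n cop a_gt0 D.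
Let simP := @shift_similarP a n cop a_gt0.

Definition periodic o E := forall j, word o E (k + j) = word o E j.

Lemma periodic_central o E : E \in dyckp -> periodic o E ->
  forall l, l < n -> k %| l -> block n o (profile_of E) (edge n o l) = vroot n o.
Proof.
move=> dyckE per; apply: periodic_block => //; first exact: prof.
move=> j lt; have := per j; rewrite !word_run; try lia.
by rewrite !step_profile => ->.
Qed.

Lemma iter_rot_fixed u q (x : {set {set 'I_n} * 'I_a.+1} * {set {set 'I_n} * 'I_a.+1}) :
  u %| q -> iter u rotp x = x -> iter q rotp x = x.
Proof.
case/dvdnP=> p -> fix_x; elim: p => // p IHp.
by rewrite mulSn iterD IHp.
Qed.

Lemma periodic_fixed o E : E \in dyckp -> periodic o E ->
  iter k rotp (part_pair E) = part_pair E.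
Proof.
move=> dyckE per.
rewrite -{1}(_ : n - (n - k) = k); last by lia.
apply: (word_rotate cop a_gt0 n_gt0 (o := o)) => //; first by lia.
move=> j; rewrite -[RHS]per (_ : k + (n - k + j) = j + n); last by lia.
by rewrite -[RHS]word_mod modnDr word_mod.
Qed.

Lemma fixed_periodic D : D \in dyckp -> iter k rotp (part_pair D) = part_pair D ->
  exists t o E, [/\ E \in dyckp, periodic o E & iter t rotp (part_pair D) = part_pair E].
Proof.
move=> dyckD fixD.
have m_gt1 : 1 < n %/ k by rewrite ltn_divRL //; lia.
(* The rotation by d = n / q has prime order q, as the counting of vertices requires; k divides d,
   so it fixes the pair too. *)
pose q := pdiv (n %/ k); have q_pr : prime q by exact: pdiv_prime.
have q_dvd : q %| n by apply: (dvdn_trans (pdiv_dvd _)); exact: dvdn_div.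
pose d := n %/ q.
have k_dvd_d : k %| d.
  rewrite /d; have := pdiv_dvd (n %/ k); rewrite -/q => /dvdnP[p def_m].
  rewrite -(divnK k_dvd) def_m -mulnA [q * k]mulnC mulnA mulnK ?prime_gt0 //.
  exact: dvdn_mull.
have d_dvd : d %| n by apply: dvdn_div.
have d_gt0 : 0 < d by rewrite divn_gt0 ?prime_gt0 // dvdn_leq.
have d_lt : d < n by rewrite ltn_Pdiv ?prime_gt1.
have fixDd : iter d rotp (part_pair D) = part_pair D by apply: (iter_rot_fixed k_dvd_d).
have [o [i [ir inv_i]]] :=
  invariant_block n_gt0 (prof dyckD) q_pr q_dvd ((simP d dyckD dyckD).1 fixDd).
have [c ltc def_i] := edge_exists o ir.
(* E is D turned so that the label i of the invariant block becomes [edge n o 0], hence its block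
   the root. *)
have [E dyckE rotE] := iter_rot_dyck cop a_gt0 n_gt0 (n - c) dyckD.
have fixE u : iter u rotp (part_pair D) = part_pair D -> iter u rotp (part_pair E) = part_pair E.
  by move=> fixu; rewrite -rotE -iterD addnC iterD fixu.
have simE := (simP (n - c) dyckD dyckE).1 rotE.
have simEd := (simP d dyckE dyckE).1 (fixE d fixDd).
have simEk := (simP k dyckE dyckE).1 (fixE k fixD).
have pE := prof dyckE.
have e0r : 0 < edge n o 0 <= n by apply: edge_range.
have block0 := block_edge0 n_gt0 o pE.
have inv0 : block n o (profile_of E) (edge n o 0) =
    block n o (profile_of E) (shift n d (edge n o 0)).
  have shift_i : shift n (n - c) i = edge n o 0.
    by rewrite def_i shift_edge // subnKC ?modnn // ltnW.
  rewrite -shift_i shiftD [n - c + d]addnC -shiftD; apply/eqP.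
  by rewrite (block_shift o simE) ?shift_range // inv_i.
have central l : l < n -> d %| l -> block n o (profile_of E) (edge n o l) = vroot n o.
  move=> ltl /dvdnP[p def_l]; elim: p l ltl def_l => [|p IHp] l ltl; first by move=> ->.
  rewrite mulSn => def_l; have ltp : p * d < n by lia.
  have -> : edge n o l = shift n d (edge n o (p * d)).
    by rewrite shift_edge // addnC -def_l modn_small.
  rewrite -block0 inv0; apply/eqP; rewrite (block_shift o simEd) ?edge_range //.
  by rewrite IHp // block0.
have edge_k : edge n o k = shift n k (edge n o 0).
  by rewrite shift_edge // add0n modn_small //; lia.
have dr : 0 < d < n by rewrite d_gt0.
have k_lt : k < n by lia.
(* Rotations commute, so the one by k takes the root to a block again invariant under d, which by
   uniqueness is the root: the symmetry by k has the same centre. *)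
have [sym _] := symmetric_block n_gt0 pE dr d_dvd central (edge_range o k_lt).
have {}sym : block n o (profile_of E) (edge n o k) = vroot n o.
  apply: sym; rewrite edge_k shiftD [k + d]addnC -shiftD; apply/eqP.
  by rewrite (block_shift o simEk) ?shift_range // inv0.
have [F dyckF wordF] := rotate_word cop a_gt0 n_gt0 dyckE k_lt sym.
(* F is E turned by n - k, a multiple of k, which leaves the labeled pair unchanged. *)
have eq_EF : E = F.
  apply: (part_pair_inj cop a_gt0 n_gt0 dyckE dyckF).
  rewrite -(word_rotate cop a_gt0 n_gt0 dyckE dyckF k_lt wordF).
  by apply/esym; apply: (@iter_rot_fixed k); [rewrite dvdn_sub|exact: fixE].
exists (n - c), o, E; split=> // j.
by rewrite {2}eq_EF wordF.
Qed.

(** The rotation carries the central vertex of E to a vertex of F invariant under k, and F has only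
    one. So the types agree and both words are read around the same vertex. *)
Lemma periodic_eq_word u o o' E F : E \in dyckp -> F \in dyckp ->
    periodic o E -> periodic o' F -> iter u rotp (part_pair E) = part_pair F ->
  o = o' /\ forall j, word o E j = word o F (u + j).
Proof.
move=> dyckE dyckF perE perF rotEF.
have sim := (simP u dyckE dyckF).1 rotEF; have [pE pF] := (prof dyckE, prof dyckF).
have lt_u : u %% n < n by rewrite ltn_mod.
have e0r : 0 < edge n o 0 <= n by apply: edge_range.
have shift0 : shift n u (edge n o 0) = edge n o (u %% n) by rewrite shift_edge.
have inv_u : block n o (profile_of F) (edge n o (u %% n)) =
    block n o (profile_of F) (shift n k (edge n o (u %% n))).
  rewrite -shift0 shiftD [u + k]addnC -shiftD; apply/eqP.
  rewrite (block_shift o sim) ?shift_range //.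
  have -> : shift n k (edge n o 0) = edge n o k by rewrite shift_edge // add0n modn_small //; lia.
  by rewrite !(periodic_central dyckE perE) //; lia.
have [sym1 sym2] := symmetric_block n_gt0 pF k_range k_dvd
  (periodic_central dyckF perF) (edge_range o lt_u).
have eq_o : o = o'.
  by case: o o' {perE perF e0r shift0} inv_u sym1 sym2 => [] [].
rewrite -eq_o in perF sym1 *; split=> //.
have [F' dyckF' wordF'] := rotate_word cop a_gt0 n_gt0 dyckF lt_u (sym1 inv_u).
have -> : E = F'.
  apply: (part_pair_inj cop a_gt0 n_gt0 dyckE dyckF').
  rewrite -(word_rotate cop a_gt0 n_gt0 dyckF dyckF' lt_u wordF') -rotEF -iterD.
  apply/esym; apply: (@iter_rot_fixed n); last exact: iter_rot_n.
  by rewrite {2}(divn_eq u n) addnCA subnK ?dvdn_add ?dvdn_mull // ltnW.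
by move=> j; rewrite wordF' -[LHS]word_mod modnDml word_mod.
Qed.

Lemma word_eq_rot u o E F : E \in dyckp -> F \in dyckp ->
    (forall j, word o E j = word o F (u + j)) ->
  iter u rotp (part_pair E) = part_pair F.
Proof.
move=> dyckE dyckF eq_w; have lt_u : u %% n < n by rewrite ltn_mod.
have eq_w' j : word o E j = word o F (u %% n + j).
  by rewrite eq_w -[RHS]word_mod modnDml word_mod.
rewrite -(word_rotate cop a_gt0 n_gt0 dyckF dyckE lt_u eq_w') -iterD.
apply: (@iter_rot_fixed n); last exact: iter_rot_n.
by rewrite {1}(divn_eq u n) -addnA subnKC ?dvdn_add ?dvdn_mull // ltnW.
Qed.
End Symmetry.

Lemma leq_card_imset_factor (T T1 T2 : finType) (A : {set T}) (f : T -> T1) (g : T -> T2) :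
  (forall x y, x \in A -> y \in A -> g x = g y -> f x = f y) -> #|f @: A| <= #|g @: A|.
Proof.
move=> factor; pose phi z := omap f [pick x in A | g x == z].
have some_inj : injective (@Some T1) by move=> ? ? [].
rewrite -(card_imset _ some_inj).
suff -> : [set Some y | y in f @: A] = phi @: (g @: A) by exact: leq_imset_card.
rewrite -!imset_comp; apply: eq_in_imset => x xA /=; rewrite /phi.
by case: pickP => [y /andP[yA /eqP eq_g]|/(_ x)]; [rewrite /= (factor y x)|rewrite xA eqxx].
Qed.

Lemma sum_periodic (w : nat -> nat) k m : (forall j, w (k + j) = w j) ->
  \sum_(j < k * m) w j = m * \sum_(j < k) w j.
Proof.
move=> per; elim: m => [|m IHm]; first by rewrite muln0 big_ord0.
rewrite mulnS big_split_ord /= mulSn -IHm; congr (_ + _).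
by apply: eq_bigr => i _; rewrite per.
Qed.

Lemma sum_shift_periodic (w : nat -> nat) n c : (forall j, w (n + j) = w j) ->
  \sum_(j < n) w (c + j) = \sum_(j < n) w j.
Proof.
move=> per; elim: c => [|c <-]; first by [].
apply/eqP; rewrite -(eqn_add2l (w (c + 0))).
have -> : w (c + 0) + \sum_(j < n) w (c.+1 + j) = \sum_(j < n.+1) w (c + j).
  by rewrite [RHS]big_ord_recl; congr (_ + _); apply: eq_bigr => i _; rewrite addSnnS.
by rewrite big_ord_recr /= addnC addnC [c + n]addnC per addn0 addnC.
Qed.

Section FixedPoints.
Variables a n k : nat.
Hypothesis cop : coprime a n.+1.
Hypothesis a_gt0 : 0 < a.
Hypothesis k_range : 0 < k < n.
Hypothesis k_dvd : k %| n.
Implicit Types D E F : n.+1.-tuple 'I_a.+1.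
Local Notation rotp := (@Defs.rot a n.+1).
Local Notation dyckp := (dyck a n.+1).
Let n_gt0 : 0 < n. Proof. by lia. Qed.
Let m := n %/ k.
Let s := a %/ m.
Let def_n : n = k * m. Proof. by rewrite mulnC divnK. Qed.
Let m_gt0 : 0 < m. Proof. by rewrite divn_gt0; [rewrite ltnW|]; lia. Qed.

(* The fixed points and the words w are images of this set by two maps with the
   same fibres; an element (E, t, o) stands for E rotated t times. *)
Definition pointed : {set n.+1.-tuple 'I_a.+1 * 'I_n * bool} :=
  [set x | (x.1.1 \in dyckp) &&
           [forall j : 'I_n, word x.2 x.1.1 (k + j) == word x.2 x.1.1 j]].

Definition pointed_pair (x : n.+1.-tuple 'I_a.+1 * 'I_n * bool) :=
  iter x.1.2 rotp (part_pair x.1.1).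

(** Rotation by t moves letter j to place t + j; n - t stands for -t modulo n. *)
Definition pointed_nat_word (x : n.+1.-tuple 'I_a.+1 * 'I_n * bool) (j : nat) : nat :=
  word x.2 x.1.1 (n - x.1.2 + j).

Definition pointed_word (x : n.+1.-tuple 'I_a.+1 * 'I_n * bool) : k.-tuple 'I_s.+1 :=
  [tuple inord (pointed_nat_word x j) | j < k].

Lemma pointedP x : reflect (x.1.1 \in dyckp /\ periodic k x.2 x.1.1) (x \in pointed).
Proof.
rewrite [x \in pointed]inE; apply: (iffP andP) => -[dyckE per]; split=> //.
  move=> j; have ltj : j %% n < n by rewrite ltn_mod.
  have /eqP := forallP per (Ordinal ltj); rewrite /= word_mod => <-.
  by rewrite -[LHS]word_mod -modnDmr word_mod.
by apply/forallP => j; rewrite per.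
Qed.

Lemma pointed_nat_word_per x : x \in pointed ->
  forall j, pointed_nat_word x (k + j) = pointed_nat_word x j.
Proof. by case/pointedP=> _ per j; rewrite /pointed_nat_word addnCA per. Qed.

Lemma sum_pointed_nat_word x : x \in pointed ->
  m * (\sum_(j < k) pointed_nat_word x j) + center_run x.2 x.1.1 = a.
Proof.
move=> xA; have [dyckE per] := pointedP _ xA.
rewrite -(sum_periodic m (pointed_nat_word_per xA)) -def_n.
rewrite /pointed_nat_word (@sum_shift_periodic (fun j => word x.2 x.1.1 j)).
  exact: sum_word.
by move=> j; rewrite -word_mod modnDl word_mod.
Qed.

Lemma pointed_wordE x : x \in pointed ->
  (forall j : 'I_k, tnth (pointed_word x) j = pointed_nat_word x j :> nat) /\
  \sum_(j <- pointed_word x) j <= s.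
Proof.
move=> xA; have sum_le : \sum_(j < k) pointed_nat_word x j <= s.
  by rewrite leq_divRL // mulnC -(sum_pointed_nat_word xA) leq_addr.
have E (j : 'I_k) : tnth (pointed_word x) j = pointed_nat_word x j :> nat.
  rewrite tnth_mktuple inordK // ltnS (leq_trans _ sum_le) //.
  by rewrite (bigD1 j) //= leq_addr.
by split=> //; rewrite big_tuple; under eq_bigr => j _ do rewrite E.
Qed.

Lemma pointed_pair_word x y : x \in pointed -> y \in pointed ->
  pointed_pair x = pointed_pair y <-> pointed_word x = pointed_word y.
Proof.
move=> xA yA; have [[dyckE perE] [dyckF perF]] := (pointedP _ xA, pointedP _ yA).
have [[Ex _] [Ey _]] := (pointed_wordE xA, pointed_wordE yA).
have [ltx lty] := (ltn_ord x.1.2, ltn_ord y.1.2).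
have word_n o (E : n.+1.-tuple 'I_a.+1) j : word o E (n + j) = word o E j.
  by rewrite -word_mod modnDl word_mod.
have rot_move : pointed_pair x = pointed_pair y <->
    iter (x.1.2 + (n - y.1.2)) rotp (part_pair x.1.1) = part_pair y.1.1.
  rewrite /pointed_pair addnC iterD; split=> [->|<-].
    by rewrite -iterD subnK ?iter_rot_n // ltnW.
  by rewrite -iterD subnKC ?iter_rot_n // ltnW.
have word_eq : pointed_word x = pointed_word y ->
    forall j, pointed_nat_word x j = pointed_nat_word y j.
  move=> eq_w j; have k0 : 0 < k by lia.
  have per_mod z i : z \in pointed -> pointed_nat_word z i = pointed_nat_word z (i %% k).
    move=> zA; rewrite [in LHS](divn_eq i k); elim: (i %/ k) => // q IHq.
    by rewrite mulSn -addnA pointed_nat_word_per.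
  rewrite (per_mod _ _ xA) (per_mod _ _ yA).
  have ltj : j %% k < k by rewrite ltn_mod.
  by rewrite -[j %% k]/(val (Ordinal ltj)) -Ex -Ey eq_w.
rewrite {}rot_move; split=> [rotEF|/word_eq eq_w].
  have {rotEF} [eq_o eq_w] := periodic_eq_word cop a_gt0 k_range k_dvd dyckE dyckF perE perF rotEF.
  apply: eq_from_tnth => j; apply: val_inj; rewrite /= Ex Ey /pointed_nat_word eq_w -eq_o.
  congr (nat_of_ord _).
  by rewrite (_ : _ + (n - x.1.2 + j) = n + (n - y.1.2 + j)) ?word_n //; lia.
have eq_center : center_run x.2 x.1.1 = center_run y.2 y.1.1 :> nat.
  apply: (@addnI (m * \sum_(j < k) pointed_nat_word x j)).
  rewrite (sum_pointed_nat_word xA) -[LHS](sum_pointed_nat_word yA).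
  by congr (m * _ + _); apply: eq_bigr => j _; rewrite eq_w.
(* A central vertex of P has an up step, one of Q a down step; so the central run, which w
   determines, gives the type. *)
have center_sign z : z \in pointed -> (a < n.+1 * center_run z.2 z.1.1) = z.2.
  case: z => [[D t] o] /pointedP[/= dyckD _]; have [g0 gn pos _] := profile_of_dyck cop a_gt0 dyckD.
  rewrite /center_run; case: o.
    by have := step_profile D 0; rewrite /step g0; have := pos 1; lia.
  by have := step_profile D n; rewrite /step gn; have := pos n; lia.
have eq_o : x.2 = y.2 by rewrite -(center_sign _ xA) -(center_sign _ yA) eq_center.
apply: (word_eq_rot cop a_gt0 k_range k_dvd (o := x.2)) => // j.
apply: val_inj; have := eq_w (x.1.2 + j); rewrite /pointed_nat_word eq_o.
rewrite (_ : n - x.1.2 + (x.1.2 + j) = n + j); last by lia.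
rewrite word_n /= => ->; congr (nat_of_ord (word _ _ _)); lia.
Qed.

Lemma pointed_pair_imset :
  pointed_pair @: pointed = [set x in NC a n.+1 | iter k rotp x == x].
Proof.
apply/setP => x; apply/imsetP/idP => [[z zA ->]|].
  have [dyckE perE] := pointedP _ zA; rewrite inE; apply/andP; split.
    have [F dyckF rotF] := iter_rot_dyck cop a_gt0 n_gt0 z.1.2 dyckE.
    by rewrite /pointed_pair rotF; apply: (imset_f (@part_pair a n)).
  by rewrite /pointed_pair -iterD addnC iterD (periodic_fixed cop a_gt0 k_range k_dvd dyckE perE).
rewrite inE => /andP[/imsetP[D dyckD ->] /eqP fixD].
have [t [o [E [dyckE perE rotE]]]] := fixed_periodic cop a_gt0 k_range k_dvd dyckD fixD.
have lt_t : (n - t %% n) %% n < n by rewrite ltn_mod.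
exists (E, Ordinal lt_t, o); first by apply/pointedP.
rewrite /pointed_pair /= (iter_rot_mod n_gt0) -rotE -(iter_rot_mod n_gt0 t) -iterD.
by rewrite subnK ?(iter_rot_n n_gt0); last by rewrite ltnW // ltn_mod.
Qed.

(** A cycle lemma for periodic words: the left-over run [r] goes to the front or to the end
    according to its size, and the word is started at a minimum of its periodic profile [G]. The
    starting point [c] reappears as the rotation. *)
Lemma pointed_word_surj (z : k.-tuple 'I_s.+1) : \sum_(j <- z) j <= s ->
  exists2 x, x \in pointed & pointed_word x = z.
Proof.
rewrite big_tuple => sum_z; have k0 : 0 < k by lia.
pose w j : nat := tnth z (Ordinal (ltn_pmod j k0)).
have w_per j : w (k + j) = w j.
  by rewrite /w; congr (nat_of_ord (tnth z _)); apply: val_inj; rewrite /= modnDl.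
have w_z (j : 'I_k) : w j = tnth z j.
  by rewrite /w; congr (nat_of_ord (tnth z _)); apply: val_inj; rewrite /= modn_small.
have sum_w : m * \sum_(j < k) w j <= a.
  under eq_bigr => j _ do rewrite w_z.
  by rewrite mulnC -leq_divRL.
have w_n c j : w (c + (n + j)) = w (c + j).
  rewrite addnCA def_n; elim: m => [|q IHq]; first by rewrite muln0.
  by rewrite mulnS -addnA w_per.
pose r := a - m * \sum_(j < k) w j.
have w_le j : w j <= a.
  have sa : s <= a by exact: leq_div.
  by apply: (leq_trans _ sa); rewrite -ltnS; apply: ltn_ord.
pose G (j : nat) : int := ((n.+1 * \sum_(i < j) w i)%N%:Z - (a * j)%N%:Z)%R.
have G0 : G 0 = 0%R by rewrite /G big_ord0; lia.
have GS j : G j.+1 = (G j + ((n.+1 * w j)%N%:Z - a%:Z))%R.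
  by rewrite /G big_ord_recr /= mulnDr mulnS; lia.
have Gk j p : G (j + k * p) = (G j + G k *+ p)%R.
  elim: p => [|p IHp]; first by rewrite muln0 addn0 mulr0n addr0.
  rewrite mulrSr addrA -IHp mulnS addnCA.
  elim: (j + k * p) => [|l IHl]; first by rewrite addn0 G0 add0r.
  by rewrite addnS !GS IHl w_per; lia.
have Gn : G n = (a%:Z - (n.+1 * r)%N%:Z)%R.
  have sum_n : \sum_(i < n) w i = m * \sum_(j < k) w j.
    by rewrite -(sum_periodic m w_per) -def_n.
  rewrite /G sum_n /r mulnBr; move: (m * _) sum_w => u le_u.
  have := leq_mul (leqnn n.+1) le_u; lia.
have Gkm : G n = (G k *+ m)%R by rewrite def_n -[k * m]add0n Gk G0 add0r.
have [c minG] : exists c : 'I_k, forall j : 'I_k, (G c <= G j)%R.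
  have [c _ minc] :=
    @Order.TotalTheory.arg_minP _ _ _ (Ordinal k0) xpredT (fun j : 'I_k => G j) isT.
  by exists c => j; apply: minc.
have Gcn : G (c + n) = (G c + G n)%R by have := Gk c m; rewrite -def_n -Gkm.
have ltc : c < n by have := ltn_ord c; lia.
pose o := a < n.+1 * r.
pose v i := if o then if i == 0 then r else w (c + i.-1) else if i == n then r else w (c + i).
pose E : n.+1.-tuple 'I_a.+1 := path_of n (fun i => inord (v i)).
have v_le i : v i <= a.
  have r_le : r <= a by rewrite leq_subr.
  by rewrite /v; case: (o); case: eqP.
have runE i : i <= n -> run E i = v i :> nat.
  by move=> le; rewrite run_path_of // inordK // ltnS.
(* G drifts by G(k) per period. If [o] holds then G(n) < 0 and the window is lowest at its end, for
   which the initial run, a step of -G(n), compensates; otherwise the drift is nonnegative and the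
   window is lowest at its start. *)
have Gge j : j <= n -> (G c + (if o then G n else 0) <= G (c + j)%N)%R.
  move=> lej; rewrite (divn_eq (c + j) k) addnC mulnC Gk.
  have := minG (Ordinal (ltn_pmod (c + j) k0)); rewrite /=.
  set y := (c + j) %% k; set p := (c + j) %/ k => minG_y.
  have [o_true|o_false] := boolP o.
    have Gk_neg : (G k < 0)%R.
      rewrite ltNge; apply/negP => Gk_ge; have : (0 <= G n)%R by rewrite Gkm mulrn_wge0.
      by rewrite Gn; rewrite /o in o_true; lia.
    have le_pm : p <= m.
      by rewrite /p -ltnS ltn_divLR // mulSn mulnC -def_n; have := ltn_ord c; lia.
    rewrite Gkm -(subnK le_pm) mulrnDr.
    have : (G k *+ (m - p) <= 0)%R by rewrite mulrn_wle0 // ltW.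
    by lia.
  have Gk_pos : (0 <= G k)%R.
    rewrite leNgt; apply/negP => Gk_lt; have : (G n < 0)%R by rewrite Gkm mulrn_wlt0 // -lt0n.
    by rewrite Gn; rewrite /o in o_false; lia.
  have : (0 <= G k *+ p)%R by rewrite mulrn_wge0.
  by lia.
have GEo j : j <= n ->
    profile_of E (o + j) = (G (c + j)%N - G c - (if o then G n else 0))%R.
  elim: j => [_|j IHj lej].
    rewrite !addn0; have [o_true|o_false] := boolP o; last by rewrite profile_of0; lia.
    have := step_profile E 0; rewrite /step profile_of0 runE // /v o_true /= Gn; lia.
  have := step_profile E (o + j); rewrite /step addnS IHj ?(ltnW lej) // addnS GS.
  rewrite runE; last by case: (o); lia.
  have -> : v (o + j) = w (c + j).
    by rewrite /v; case: (o) => //=; rewrite ltn_eqF.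
  by lia.
have dyckE : E \in dyckp.
  apply: dyck_profile.
    have [o_true|o_false] := boolP o.
      by have := GEo n (leqnn n); rewrite o_true add1n => ->; rewrite Gcn; lia.
    have := step_profile E n; rewrite /step runE // /v (negbTE o_false) eqxx.
    have := GEo n (leqnn n); rewrite (negbTE o_false) add0n => ->.
    by rewrite Gcn Gn; lia.
  move=> i lei; have [o_true|o_false] := boolP o.
    case: i lei => [|i] lei; first by rewrite profile_of0.
    by have := GEo i (ltnW lei); have := Gge i (ltnW lei); rewrite o_true add1n => le ->; lia.
  by have := GEo i lei; have := Gge i lei; rewrite (negbTE o_false) add0n => le ->; lia.
have wordE j : word o E j = w (c + j) :> nat.
  have ltj : j %% n < n by rewrite ltn_mod.
  rewrite /word runE; last by case: (o); lia.
  have -> : v (o + j %% n) = w (c + j %% n).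
    by rewrite /v; case: (o) => //=; rewrite ltn_eqF.
  rewrite [in RHS](divn_eq j n); elim: (j %/ n) => // q IHq.
  by rewrite mulSn -addnA w_n.
exists (E, Ordinal ltc, o).
  apply/pointedP; split=> // j; apply: val_inj; rewrite /= !wordE.
  by rewrite addnCA w_per.
apply: eq_from_tnth => j; apply: val_inj; rewrite tnth_mktuple /pointed_nat_word /= wordE.
rewrite (_ : c + (n - c + j) = 0 + (n + j)); last by lia.
by rewrite w_n add0n w_z inordK.
Qed.

Lemma card_fixed : #|[set x in NC a n.+1 | iter k rotp x == x]| = 'C(k + s, k).
Proof.
rewrite -pointed_pair_imset -card_partial_ord_partitions.
have -> : [set t : k.-tuple 'I_s.+1 | \sum_(i <- t) i <= s] = pointed_word @: pointed.
  apply/setP => z; rewrite inE; apply/idP/imsetP => [/pointed_word_surj[x xA <-]|[x xA ->]].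
    by exists x.
  by have [] := pointed_wordE xA.
apply/eqP; rewrite eqn_leq; apply/andP; split; apply: leq_card_imset_factor => x y xA yA.
  by move/(pointed_pair_word xA yA).
by move/(pointed_pair_word xA yA).
Qed.
End FixedPoints.

(** * Cyclic sieving *)

Section CycleLemma.
Variables a n : nat.
Hypothesis cop : coprime a n.+1.
Hypothesis a_gt0 : 0 < a.
Implicit Types D E : n.+1.-tuple 'I_a.+1.
Local Notation dyckp := (dyck a n.+1).

Definition rotate_path (c : nat) D : n.+1.-tuple 'I_a.+1 :=
  path_of n (fun i => run D ((i + c) %% n.+1)).

Lemma run_rotate_path c D i : i <= n -> run (rotate_path c D) i = run D ((i + c) %% n.+1).
Proof. by move=> le; rewrite run_path_of. Qed.

Lemma rotate_pathD c d D : rotate_path c (rotate_path d D) = rotate_path (c + d) D.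
Proof.
apply: eq_run => i le; rewrite !run_rotate_path //; last by rewrite -ltnS ltn_mod.
by rewrite modnDml addnA.
Qed.

Lemma rotate_path_full q D : rotate_path (q * n.+1) D = D.
Proof.
by apply: eq_run => i le; rewrite run_rotate_path // addnC modnMDl modn_small.
Qed.

Lemma profile_rotate_pathL c D j : c <= n.+1 -> j <= n.+1 - c ->
  profile_of (rotate_path c D) j = (profile_of D (c + j)%N - profile_of D c)%R.
Proof.
move=> lec; elim: j => [|j IHj] lej; first by rewrite profile_of0 addn0 subrr.
have := step_profile (rotate_path c D) j.
rewrite /step IHj ?(ltnW lej) // run_rotate_path; last by lia.
rewrite modn_small; last by lia.
by have := step_profile D (c + j); rewrite /step addnS [j + c]addnC; lia.
Qed.

Lemma profile_rotate_pathR c D j : c <= n -> j <= c ->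
  profile_of (rotate_path c D) (n.+1 - c + j) =
    (profile_of D n.+1 + profile_of D j - profile_of D c)%R.
Proof.
move=> lec; elim: j => [|j IHj] lej.
  rewrite addn0 profile_rotate_pathL ?(leqW lec) // profile_of0 addr0.
  by rewrite subnKC // leqW.
have := step_profile (rotate_path c D) (n.+1 - c + j).
rewrite /step addnS IHj ?(ltnW lej) // run_rotate_path; last by lia.
rewrite (_ : n.+1 - c + j + c = j + n.+1); last by lia.
rewrite modnDr modn_small; last by lia.
by have := step_profile D j; rewrite /step; lia.
Qed.

(** A rotation by c > 0 would create the height -g(c) < 0 at n + 1 - c. *)
Lemma rotate_dyck_inj c D E : D \in dyckp -> E \in dyckp -> c <= n ->
  rotate_path c D = E -> c = 0.
Proof.
move=> dyckD dyckE lec rotD.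
have [_ gn pos _] := profile_of_dyck cop a_gt0 dyckD.
have [h0 hn hpos _] := profile_of_dyck cop a_gt0 dyckE.
case: c lec rotD => // c lec rotD.
have := @profile_rotate_pathL c.+1 D (n.+1 - c.+1) (leqW lec) (leqnn _).
rewrite subnKC ?(leqW lec) // gn rotD.
by have := pos c.+1; have := hpos (n.+1 - c.+1); lia.
Qed.

(** The right side counts sequences of n + 1 runs with sum a. Each has exactly one rotation that is
    a Dyck path, the one starting at the minimum of its profile. *)
Lemma card_dyck : #|dyckp| * n.+1 = 'C(n + a, n).
Proof.
rewrite -card_ord_partitions; transitivity #|setX dyckp [set: 'I_n.+1]|.
  by rewrite cardsX cardsT card_ord.
pose f (x : n.+1.-tuple 'I_a.+1 * 'I_n.+1) := rotate_path x.2 x.1.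
have sumE D : \sum_(i <- D) i = height D n.+1.
  by rewrite big_tuple /height; apply: eq_bigr => i _; rewrite (tnth_nth ord0).
transitivity #|f @: setX dyckp [set: 'I_n.+1]|.
  symmetry; apply: card_in_imset.
  move=> [D c] [E d] /setXP[/= dyckD _] /setXP[/= dyckE _]; rewrite /f /= => eq_rot.
  wlog le : c d D E dyckD dyckE eq_rot / d <= c.
    by case: (leqP d c) => [le|/ltnW le] => hw; [exact: hw|apply/esym/hw].
  have [ltc ltd] := (ltn_ord c, ltn_ord d).
  have rotD : rotate_path (c - d) D = E.
    have := congr1 (rotate_path (n.+1 - d)) eq_rot.
    rewrite !rotate_pathD (_ : n.+1 - d + d = 1 * n.+1); last by lia.
    rewrite rotate_path_full (_ : n.+1 - d + c = c - d + 1 * n.+1); last by lia.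
    by rewrite -rotate_pathD rotate_path_full.
  have cd0 : c - d = 0 by apply: rotate_dyck_inj rotD => //; lia.
  have eq_cd : c = d by apply: val_inj => /=; lia.
  by move: rotD; rewrite cd0 -(mul0n n.+1) rotate_path_full eq_cd => ->.
apply: eq_card => E; rewrite inE sumE.
apply/imsetP/idP => [[[D c] /setXP[/= dyckD _] ->]|/eqP sumEa].
  have lec : c <= n by rewrite -ltnS.
  have := profile_rotate_pathR D lec (leqnn c); rewrite subnK; last by lia.
  have [_ -> _ _] := profile_of_dyck cop a_gt0 dyckD.
  by rewrite /f /= /profile_of; nia.
have gn : profile_of E n.+1 = 0%R by rewrite /profile_of sumEa; lia.
have [c _ minc] := @Order.TotalTheory.arg_minP _ _ _ (ord0 : 'I_n.+1) xpredT
  (fun j : 'I_n.+1 => profile_of E j) isT.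
have lec : c <= n by rewrite -ltnS.
have min_le j : j <= n.+1 -> (profile_of E c <= profile_of E j)%R.
  rewrite leq_eqVlt => /orP[/eqP ->|lt]; last exact: (minc (Ordinal lt)).
  by rewrite gn; have := minc ord0 isT; rewrite /= profile_of0.
have dyckD : rotate_path c E \in dyckp.
  apply: dyck_profile.
    have := profile_rotate_pathR E lec (leqnn c); rewrite subnK ?(leqW lec) // => ->.
    by rewrite gn; lia.
  move=> j lej; case: (leqP j (n.+1 - c)) => [le|gt].
    by rewrite profile_rotate_pathL ?(leqW lec) // subr_ge0 min_le //; lia.
  have -> : j = n.+1 - c + (j - (n.+1 - c)) by lia.
  rewrite profile_rotate_pathR //; last by lia.
  by rewrite gn add0r subr_ge0 min_le //; lia.
have lt_d : (n.+1 - c) %% n.+1 < n.+1 by rewrite ltn_mod.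
exists (rotate_path c E, Ordinal lt_d); first by apply/setXP.
rewrite /f /= rotate_pathD; apply: eq_run => i lei; rewrite run_rotate_path //.
have eq0 : ((n.+1 - c) %% n.+1 + c) %% n.+1 = 0 by rewrite modnDml subnK ?modnn ?(leqW lec).
by rewrite -modnDmr eq0 addn0 modn_small.
Qed.
End CycleLemma.

Lemma iter_gcd (T : eqType) (f : T -> T) x d m : iter m f x = x ->
  (iter d f x == x) = (iter (gcdn m d) f x == x).
Proof.
move=> fixm; have iterM u q : iter u f x = x -> iter (q * u) f x = x.
  by move=> fixu; elim: q => // q IHq; rewrite mulSn iterD IHq.
case: d => [|d]; first by rewrite gcdn0 fixm.
apply/eqP/eqP => [fixd|fixg].
  have [u v Euv _] := egcdnP m (ltn0Sn d).
  have := iterM _ u fixd; rewrite Euv addnC iterD iterM // gcdnC.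
  by move=> ->.
by have /dvdnP[q ->] := dvdn_gcdr m d.+1; apply: iterM.
Qed.

Theorem theorem6p3 (a b : nat) (a_gt0 : (0 < a)%N) (b_ge2 : (2 <= b)%N)
    (coprime_ab : coprime a b) :
  cyclic_sieving (rot_action a b) (NC a b) [set: 'I_(b.-2).+1]%G (Zp1 : 'I_(b.-2).+1)
    (qCat a b).
Proof.
case: b b_ge2 coprime_ab => [|[|n']] // _ cop.
set n := n'.+1; have n_gt0 : 0 < n by [].
have rotK (x : {set {set 'I_n} * 'I_a.+1} * {set {set 'I_n} * 'I_a.+1}) :
  iter n (@Defs.rot a n.+1) x = x by apply: iter_rot_n.
have iterNC t x : x \in NC a n.+1 -> iter t (@Defs.rot a n.+1) x \in NC a n.+1.
  case/imsetP=> D dyckD ->; have [E dyckE rotE] := iter_rot_dyck cop a_gt0 n_gt0 t dyckD.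
  by rewrite -/(part_pair D) rotE; apply: (imset_f (@part_pair a n)).
split.
- by rewrite /= Zp_cycle.
- apply/actsP => c _ x; apply/idP/idP => [xc|]; last exact: iterNC.
  have := iterNC (n - c) _ xc; rewrite /= /rot_fun -iterD subnK ?rotK //.
  by apply/ltnW/ltn_ord.
- by apply: qCat_nat.
move=> zeta; rewrite cardsT card_ord => prim d.
have prim_d := exp_prim_root prim d.
(* zeta^d has order m = n / k and, by Bezout, the d-th and k-th powers of the rotation have the same
   fixed points. *)
set k := gcdn d n in prim_d; set m := n %/ k in prim_d.
have k_dvd : k %| n by exact: dvdn_gcdr.
have k_gt0 : 0 < k by rewrite gcdn_gt0 n_gt0 orbT.
have def_n : n = m * k by rewrite divnK.
have := horner_qCat cop def_n prim_d.
have -> : #|('Fix_(NC a n.+1 | rot_action a n.+1)[Zp1 ^+ d])%g| =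
    #|[set x in NC a n.+1 | iter k (@Defs.rot a n.+1) x == x]|.
  apply: eq_card => x; rewrite !inE; congr (_ && _).
  rewrite sub1set inE Zp_expg.
  (* [Zp1] is 1 modulo n, which is 0 when n = 1; hence [1 %% n]. *)
  change (rot_action a n.+1 x (inZp ((Zp1 : 'I_n) * d)))
    with (iter ((1 %% n * d) %% n) (@Defs.rot a n.+1) x).
  by rewrite modnMml mul1n iter_rot_mod // (iter_gcd _ (rotK x)) gcdnC.
(* For k = n every pair is fixed, and the factor n + 1 of the cycle lemma matches the value of
   [n + 1] at 1. *)
have [k_n|k_lt] := eqVneq k n.
  have m1 : m = 1 by rewrite /m k_n divnn.
  have -> : [set x in NC a n.+1 | iter k (@Defs.rot a n.+1) x == x] = NC a n.+1.
    by apply/setP => x; rewrite inE k_n rotK eqxx andbT.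
  rewrite m1 /= divn1 k_n -(card_dyck cop a_gt0) natrM.
  have -> : #|NC a n.+1| = #|dyck a n.+1|.
    apply: card_in_imset => D E dyckD dyckE.
    exact: (part_pair_inj cop a_gt0 n_gt0 dyckD dyckE).
  by apply: mulIf; rewrite pnatr_eq0.
have kr : 0 < k < n by rewrite k_gt0 ltn_neqAle k_lt dvdn_leq.
rewrite (card_fixed cop a_gt0 kr k_dvd) ifF ?mulr1 //.
apply/negP => /eqP m1; move: def_n; rewrite m1 mul1n => def_n.
by rewrite def_n eqxx in k_lt.
Qed.
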